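(* Let $\alpha>0$ and $\lambda>0$, and let $f:[0,1]\times\mathbb{R}\to\mathbb{R}$ be a continuous function such that $$|f(t,x_1)-f(t,x_2)|\leq C_f|x_1-x_2|,\quad (t,x_1,x_2)\in[0,1]\times\mathbb{R}\times\mathbb{R},$$ where $C_f>0$ is a constant satisfying $$\alpha\left(\lambda+C_f\right)\int_0^\infty P\left(s,\frac{1}{\alpha}\right)\,ds<1.$$ Then the problem $$\left(\mathcal{D}_0^\alpha u\right)(t)+\lambda u(t)=f(t,u(t))\ \text{ for a.e. } t\in[0,1],\qquad \left(J_0^\alpha u\right)(0)=0,$$ admits one and only one solution $u^*\in C([0,1];\mathbb{R})$. Moreover, for every $u_0\in C([0,1];\mathbb{R})$, the Picard sequence $\{u_n\}\subset C([0,1];\mathbb{R})$ given for $n=0,1,2,\dots$ by $$u_{n+1}(t)=\int_0^t \mathcal{S}\left(\frac{t-y}{\alpha}\right)\big[-\lambda u_n(y)+f(y,u_n(y))\big]\,dy\ \text{ if } 0<t\leq 1,\qquad u_{n+1}(0)=0,$$ converges uniformly to $u^*$.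
   Context: Let $E_1(x)=\int_x^\infty \frac{e^{-t}}{t}\,dt$ for $x>0$ and $\mathcal{S}(t)=e^{-t}\int_0^\infty \frac{t^{s-1}}{\Gamma(s)}\,ds$ for $t>0$, where $\Gamma$ is the Gamma function. The regularized lower Gamma function is $P(s,x)=\frac{1}{\Gamma(s)}\int_0^x t^{s-1}e^{-t}\,dt$ for $s>0$, $x>0$. For $\alpha>0$ and $u\in L^1([0,1];\mathbb{R})$, let $$(J_0^\alpha u)(x)=\frac{1}{\alpha}\int_0^x E_1\left(\frac{x-t}{\alpha}\right)u(t)\,dt\quad\text{for a.e. } x\in[0,1].$$ A function in $L^1([0,1];\mathbb{R})$ has an absolutely continuous representative if it coincides a.e. on $[0,1]$ with an absolutely continuous function on $[0,1]$; it is then identified with that function (so $(J_0^\alpha u)(0)$ is the value at $0$ of that representative). If $J_0^\alpha u$ has an absolutely continuous representative, the left-sided fractional derivative of order $\alpha$ of $u$ is $(\mathcal{D}_0^\alpha u)(x)=\frac{d}{dx}(J_0^\alpha u)(x)$ for a.e. $x\in[0,1]$. A solution to the problem means a function $u\in C([0,1];\mathbb{R})$ such that $J_0^\alpha u$ admits an absolutely continuous representative and $u$ satisfies both the equation for a.e. $t\in[0,1]$ and the condition $(J_0^\alpha u)(0)=0$. *)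

(* Defs.v *)
From mathcomp Require Import all_boot all_order all_algebra.
From mathcomp Require Import all_classical all_reals all_analysis.

Set Implicit Arguments.
Unset Strict Implicit.
Unset Printing Implicit Defensive.

Import Order.TTheory GRing.Theory Num.Theory.
Import numFieldNormedType.Exports.

Local Open Scope classical_set_scope.
Local Open Scope ring_scope.

(* Functions on [0, 1] are represented by total functions on R of which only
   the restriction to [0, 1] is meaningful. *)

Section special_functions.
Context {R : realType}.
Local Notation mu := (@lebesgue_measure R).

Definition expint1 (x : R) : R := \int[mu]_(t in `[x, +oo[) (expR (- t) / t).

Definition Gamma (s : R) : R :=
  \int[mu]_(t in `]0%R, +oo[) (t `^ (s - 1) * expR (- t)).

Definition lower_gammaP (s x : R) : R :=
  (Gamma s)^-1 * \int[mu]_(t in `]0%R, x[) (t `^ (s - 1) * expR (- t)).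

Definition kernelS (t : R) : R :=
  expR (- t) * \int[mu]_(s in `]0%R, +oo[) (t `^ (s - 1) / Gamma s).

End special_functions.

Section absolute_continuity.
Context {R : realType}.

Definition abs_continuous (a b : R) (g : R -> R) : Prop :=
  forall e : R, 0 < e -> exists2 d : R, 0 < d &
    forall (n : nat) (l r : 'I_n -> R),
      (forall i, a <= l i /\ l i <= r i /\ r i <= b) ->
      trivIset [set: 'I_n] (fun i => `](l i), (r i)[%classic) ->
      \sum_(i < n) (r i - l i) < d ->
      \sum_(i < n) `|g (r i) - g (l i)| < e.

Definition is_ac_rep (h g : R -> R) : Prop :=
  abs_continuous 0 1 g /\
  {ae (@lebesgue_measure R), forall x, 0 <= x <= 1 -> h x = g x}.

Definition has_ac_rep (h : R -> R) : Prop := exists g, is_ac_rep h g.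

(* Two such representatives coincide on [0, 1], so the choice made by xget
   does not affect values on [0, 1] nor derivatives on ]0, 1[. *)
Definition ac_rep (h : R -> R) : R -> R := xget h [set g | is_ac_rep h g].

End absolute_continuity.

Section fractional_calculus.
Context {R : realType}.
Local Notation mu := (@lebesgue_measure R).

Definition frac_int (alpha : R) (u : R -> R) (x : R) : R :=
  alpha^-1 * \int[mu]_(t in `]0%R, x[) (expint1 ((x - t) / alpha) * u t).

Definition frac_derivable (alpha : R) (u : R -> R) (x : R) : Prop :=
  derivable (ac_rep (frac_int alpha u)) x 1.

Definition frac_deriv (alpha : R) (u : R -> R) (x : R) : R :=
  derive1 (ac_rep (frac_int alpha u)) x.

(* Derivability is required explicitly because derive1 is total; absolutely
   continuous functions being derivable a.e., it is not an extra condition. *)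
Definition is_solution (alpha lambda : R) (f : R -> R -> R) (u : R -> R) : Prop :=
  [/\ {within `[0%R, 1%R], continuous u},
      has_ac_rep (frac_int alpha u),
      {ae mu, forall t, 0 <= t <= 1 ->
        frac_derivable alpha u t /\
        frac_deriv alpha u t + lambda * u t = f t (u t)} &
      ac_rep (frac_int alpha u) 0 = 0].

Definition picard (alpha lambda : R) (f : R -> R -> R) (u : R -> R) (t : R) : R :=
  if 0 < t then
    \int[mu]_(y in `]0%R, t[)
      (kernelS ((t - y) / alpha) * (- lambda * u y + f y (u y)))
  else 0.

End fractional_calculus.

(* Main.v *)
Require Import Defs.
From mathcomp Require Import all_boot all_order all_algebra.
From mathcomp Require Import all_classical all_reals all_analysis.
From mathcomp Require Import measurable_realfun.
From mathcomp Require Import ring lra.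

(* Put [p_s(t) = t^(s-1) e^(-t) / Gamma(s)] for [t > 0].  These Gamma densities
   form a convolution semigroup and [S = \int_0^oo p_s ds], so that
   [p_e * S = \int_e^oo p_s ds] and [H * (S - p_e * S) = \int_0^e P(s, .) ds],
   with [H] the indicator of ]0, +oo[.  Now [Gamma(e) (H - H * p_e)] is the tail
   [t |-> \int_t^oo r^(e-1) e^(-r) dr], which tends to [E1] as [e -> 0+], while
   [Gamma(e) ~ 1/e] and [P(s, .) -> 1] as [s -> 0+]: hence [E1 * S = 1].
   Consequently a continuous [u] solves the problem if and only if
   [u = S(./alpha) * (- lambda u + f(., u))] on [0, 1], and the right-hand side is
   a contraction for the sup norm, of ratio
   [(lambda + Cf) \int_0^1 S(t/alpha) dt = alpha (lambda + Cf) \int_0^oo P(s, 1/alpha) ds].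
   The converse direction uses that an absolutely continuous function is the
   primitive of its derivative.

   Convolutions are computed with extended-real integrals of nonnegative
   functions on the whole line, vanishing on ]-oo, 0]; the hypothesis makes
   [H * S] finite up to [1/alpha], which is all that is needed. *)

Set Implicit Arguments.
Unset Strict Implicit.
Unset Printing Implicit Defensive.

Import Order.TTheory GRing.Theory Num.Theory.
Import numFieldNormedType.Exports.

Local Open Scope classical_set_scope.
Local Open Scope ring_scope.

(** * Convolution of nonnegative functions on the line *)

Section convolution.
Context {R : realType}.
Local Open Scope ereal_scope.
Local Notation mu := (@lebesgue_measure R).

(** On Laplace transforms the Sonine identity reads [(ln (1 + z) / z) * (1 / ln (1 + z)) = 1 / z],
    the transform of [p_s] being [(1 + z)^(-s)]; the semigroup law replaces these transforms. The
    obstacle is that [E1] belongs to the excluded parameter [s = 0], where [Gamma] is infinite and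
    [p_s] degenerates to a Dirac mass. Hence the detour through [e > 0] and two one-sided limits,
    which are not symmetric: [r^e <= 1 + e * r] holds on the whole half-line, whereas [r^e] has no
    positive lower bound near [r = 0], which forces a truncation away from 0, removed afterwards by
    monotone convergence. [S] is unbounded at 0, where it behaves like [1 / (t * (ln t)^2)]. Kernels
    are therefore controlled through their integrals only, and the functions they act on through sup
    norms. Signed functions enter as differences of nonnegative ones, and identities stay additive
    until finiteness permits subtraction. *)

Definition nnm (a : R -> \bar R) : Prop :=
  measurable_fun setT a /\ forall x, 0 <= a x.

Definition econv (a b : R -> \bar R) (x : R) : \bar R :=
  \int[mu]_y (a (x - y)%R * b y).

(** Lebesgue measure is determined by its values on half-open intervals. Reflection only moves the
    closed end to the other side, which leaves the length unchanged. *)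
Lemma lebesgue_measure_reflect (x : R) (A : set R) : measurable A ->
  pushforward mu ((fun y => (x - y)%R) : _ -> measurableTypeR R) A = mu A.
Proof.
move=> mA.
have mphi : measurable_fun setT ((fun y : R => (x - y)%R) : _ -> measurableTypeR R).
  by apply: measurable_funB.
apply/esym/lebesgue_measure_unique => //= _ [[a b]] _ <-.
rewrite /pushforward.
rewrite (_ : _ @^-1` _ = `[(x - b)%R, (x - a)%R[%classic); last first.
  by apply/seteqP; split => y /=; rewrite !in_itv/=; lra.
rewrite !lebesgue_measure_itv/= !lte_fin.
rewrite ltrD2l ltrN2; case: ifP => // _; rewrite -!EFinD; congr (_%:E); ring.
Qed.

Lemma lebesgue_measure_dilate (c : R) (A : set R) : (0 < c)%R -> measurable A ->
  pushforward mu ((fun y => c * y)%R : _ -> measurableTypeR R) A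
  = (c^-1)%:E * mu A.
Proof.
move=> c0 mA.
have mphi : measurable_fun setT ((fun y => c * y)%R : _ -> measurableTypeR R).
  by apply: measurable_funM.
pose cn : {nonneg R} := NngNum (ltW c0).
(* The pushforward is first scaled by [c]: this multiple gives intervals their length, so uniqueness
   applies to it. *)
suff -> : mu A = pushforward (mscale cn mu) ((fun y => c * y)%R : _ -> measurableTypeR R) A.
  by rewrite /pushforward /mscale/= muleA -EFinM mulVf ?gt_eqF// mul1e.
apply/lebesgue_measure_unique => //= _ [[a b]] _ <-.
rewrite /mscale /pushforward/=.
rewrite (_ : _ @^-1` _ = `](a / c)%R, (b / c)%R]%classic); last first.
  apply/seteqP; split => y /=; rewrite !in_itv/=;
    by rewrite ltr_pdivrMr// ler_pdivlMr// ![(y * c)%R]mulrC.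
rewrite !lebesgue_measure_itv/= !lte_fin ltr_pM2r ?invr_gt0//.
case: ifP => _; last by rewrite mule0.
rewrite -!EFinD -EFinM; congr (_%:E); field; lra.
Qed.

Lemma integral_reflect (x : R) (F : R -> \bar R) : nnm F ->
  \int[mu]_y F (x - y)%R = \int[mu]_y F y.
Proof.
move=> [mF F0]; symmetry.
have mphi : measurable_fun setT ((fun y : R => (x - y)%R) : _ -> measurableTypeR R).
  by apply: measurable_funB.
transitivity (\int[pushforward mu ((fun y => (x - y)%R) : _ -> measurableTypeR R)]_y F y).
  by apply: eq_measure_integral => A mA _; exact/esym/lebesgue_measure_reflect.
by rewrite ge0_integral_pushforward.
Qed.

Lemma nnm_comp (F : R -> \bar R) (h : R -> R) :
  nnm F -> measurable_fun setT h -> nnm (fun x => F (h x)).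
Proof. by move=> [mF F0] mh; split => //; exact: measurableT_comp. Qed.

(** A translation is the composite of two reflections. *)
Lemma integral_shift (x : R) (F : R -> \bar R) : nnm F ->
  \int[mu]_y F (y - x)%R = \int[mu]_y F y.
Proof.
move=> nF; rewrite -[RHS](@integral_reflect (- x)%R)//.
rewrite -[LHS](@integral_reflect 0%R).
  by apply: eq_integral => y _; rewrite sub0r addrC.
by apply: nnm_comp => //; exact: measurable_funB.
Qed.

Lemma integral_dilate (c : R) (F : R -> \bar R) : (0 < c)%R -> nnm F ->
  \int[mu]_y F (c * y)%R = (c^-1)%:E * \int[mu]_y F y.
Proof.
move=> c0 [mF F0]; symmetry.
have mphi : measurable_fun setT ((fun y => c * y)%R : _ -> measurableTypeR R).
  by apply: measurable_funM.
have ci0 : (0 <= c^-1)%R by rewrite invr_ge0 ltW.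
pose cn : {nonneg R} := NngNum ci0.
transitivity (\int[mscale cn mu]_y F y); first by rewrite ge0_integral_mscale.
transitivity (\int[pushforward mu ((fun y => c * y)%R : _ -> measurableTypeR R)]_y F y).
  by apply: eq_measure_integral => A mA _; exact/esym/lebesgue_measure_dilate.
by rewrite ge0_integral_pushforward.
Qed.

Lemma tonelli (F : R * R -> \bar R) : measurable_fun setT F ->
  (forall z, 0 <= F z) ->
  \int[mu]_x \int[mu]_y F (x, y) = \int[mu]_y \int[mu]_x F (x, y).
Proof. by move=> mF F0; exact: (@fubini_tonelli _ _ _ _ _ mu mu). Qed.

Lemma nnm_integral (F : R * R -> \bar R) : measurable_fun setT F ->
  (forall z, 0 <= F z) -> nnm (fun x => \int[mu]_y F (x, y)).
Proof.
move=> mF F0; split; last by move=> x; exact: integral_ge0.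
exact: measurable_fun_fubini_tonelli_F.
Qed.

Lemma nnm_mul a b : nnm a -> nnm b -> nnm (fun x => a x * b x).
Proof.
move=> [ma a0] [mb b0]; split; first exact: emeasurable_funM.
by move=> x; exact: mule_ge0.
Qed.

Lemma nnm_add a b : nnm a -> nnm b -> nnm (fun x => a x + b x).
Proof.
move=> [ma a0] [mb b0]; split; first exact: emeasurable_funD.
by move=> x; exact: adde_ge0.
Qed.

Lemma nnm_scale (c : \bar R) a : 0 <= c -> nnm a -> nnm (fun x => c * a x).
Proof. by move=> c0 na; apply: (@nnm_mul (cst c)) => //; split. Qed.

Lemma measurable_conv_integrand a b : nnm a -> nnm b ->
  measurable_fun setT (fun z : R * R => a (z.1 - z.2)%R * b z.2).
Proof.
move=> [ma a0] [mb b0]; apply: emeasurable_funM.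
  by apply: (measurableT_comp ma); exact: measurable_funB.
exact: (measurableT_comp mb).
Qed.

Lemma nnm_econv_integrand a b x : nnm a -> nnm b ->
  nnm (fun y => a (x - y)%R * b y).
Proof.
by move=> na nb; apply: nnm_mul => //; apply: nnm_comp => //; exact: measurable_funB.
Qed.

Lemma nnm_econv a b : nnm a -> nnm b -> nnm (econv a b).
Proof.
move=> na nb.
apply: (@nnm_integral (fun z => a (z.1 - z.2)%R * b z.2)).
  exact: measurable_conv_integrand.
by move=> z; apply: mule_ge0; [apply na.2|apply nb.2].
Qed.

Lemma econvC a b : nnm a -> nnm b -> econv a b = econv b a.
Proof.
move=> na nb; apply/funext => x; rewrite /econv.
rewrite -(@integral_reflect x); last exact: nnm_econv_integrand.
by apply: eq_integral => y _; rewrite subKr muleC.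
Qed.

Lemma econvA a b c : nnm a -> nnm b -> nnm c ->
  econv (econv a b) c = econv a (econv b c).
Proof.
move=> na nb nc; apply/funext => x; rewrite /econv.
have [[[ma a0] [mb b0]] [mc c0]] := (na, nb, nc).
(* [F] is the common integrand once the inner variable on the left has been translated by [z].
   Nonnegativity lets Tonelli swap the integrals without any finiteness. *)
pose F (z : R * R) := a (x - z.2)%R * b (z.2 - z.1)%R * c z.1.
have mF : measurable_fun setT F.
  apply: emeasurable_funM; last exact: (measurableT_comp mc).
  apply: emeasurable_funM.
    by apply: (measurableT_comp ma); apply: measurable_funB.
  by apply: (measurableT_comp mb); exact: measurable_funB.
have F0 z : 0 <= F z by rewrite !mule_ge0.
transitivity (\int[mu]_z \int[mu]_y F (z, y)).
  apply: eq_integral => z _; rewrite muleC -ge0_integralZl//; last 2 first.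
  - by case: (nnm_econv_integrand (x - z)%R na nb).
  - by move=> y _; rewrite mule_ge0.
  rewrite -[LHS](@integral_shift z).
    by apply: eq_integral => y _; rewrite /F/= muleC; congr (a _ * _ * _); ring.
  by apply: nnm_scale => //; exact: nnm_econv_integrand.
rewrite (tonelli mF F0); apply: eq_integral => y _.
rewrite -ge0_integralZl//; last 2 first.
- by case: (nnm_econv_integrand y nb nc).
- by move=> z _; rewrite mule_ge0.
by apply: eq_integral => z _; rewrite /F/= muleA.
Qed.

Lemma econvDl a b c : nnm a -> nnm b -> nnm c ->
  econv (fun x => a x + b x) c = (fun x => econv a c x + econv b c x).
Proof.
move=> na nb nc; apply/funext => x; rewrite /econv -ge0_integralD//; last 4 first.
- by move=> y _; case: (nnm_econv_integrand x na nc).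
- by case: (nnm_econv_integrand x na nc).
- by move=> y _; case: (nnm_econv_integrand x nb nc).
- by case: (nnm_econv_integrand x nb nc).
by apply: eq_integral => y _; rewrite ge0_muleDl//; [apply na.2|apply nb.2].
Qed.

Lemma econvDr a b c : nnm a -> nnm b -> nnm c ->
  econv a (fun x => b x + c x) = (fun x => econv a b x + econv a c x).
Proof.
move=> na nb nc; rewrite econvC//; last exact: nnm_add.
by rewrite econvDl// (econvC na nb) (econvC na nc).
Qed.

Lemma econvZl (c : \bar R) a b : 0 <= c -> nnm a -> nnm b ->
  econv (fun x => c * a x) b = (fun x => c * econv a b x).
Proof.
move=> c0 na nb; apply/funext => x; rewrite /econv -ge0_integralZl//; last 2 first.
- by case: (nnm_econv_integrand x na nb).
- by move=> y _; case: (nnm_econv_integrand x na nb).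
by apply: eq_integral => y _; rewrite muleA.
Qed.

Lemma econvZr (c : \bar R) a b : 0 <= c -> nnm a -> nnm b ->
  econv a (fun x => c * b x) = (fun x => c * econv a b x).
Proof.
move=> c0 na nb; rewrite econvC ?econvZl//; last exact: nnm_scale.
by rewrite econvC.
Qed.

Lemma le_econv a b a' b' x : nnm a -> nnm b -> nnm a' -> nnm b' ->
  (forall y, a y <= a' y) -> (forall y, b y <= b' y) ->
  econv a b x <= econv a' b' x.
Proof.
move=> na nb na' nb' aa' bb'; apply: ge0_le_integral => //.
- by move=> y _; case: (nnm_econv_integrand x na nb).
- by case: (nnm_econv_integrand x na nb).
- by case: (nnm_econv_integrand x na' nb').
- by move=> y _; apply: lee_pmul => //; [apply na.2|apply nb.2].
Qed.

Lemma integral_econv a b : nnm a -> nnm b ->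
  \int[mu]_x econv a b x = (\int[mu]_x a x) * (\int[mu]_x b x).
Proof.
move=> na nb; rewrite /econv.
rewrite (@tonelli (fun z => a (z.1 - z.2)%R * b z.2))/=; last 2 first.
- exact: measurable_conv_integrand.
- by move=> z; apply: mule_ge0; [apply na.2|apply nb.2].
have [ma a0] := na; have [mb b0] := nb.
rewrite -ge0_integralZl//; last exact: integral_ge0.
apply: eq_integral => y _; rewrite -(integral_shift y na) muleC.
under eq_integral do rewrite muleC.
rewrite ge0_integralZl//; last by case: (nnm_comp na (@measurable_funB _ _ _ setT id (cst y) (@measurable_id _ _ _) (@measurable_cst _ _ _ _ _ _))).
Qed.

(** Serves to move a convolution under the integral over [s] that defines [S], or its part
    [s <= e]. *)
Lemma econv_integral_param (F : R * R -> \bar R) b x :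
  measurable_fun setT F -> (forall z, 0 <= F z) -> nnm b ->
  econv b (fun t => \int[mu]_s F (t, s)) x
  = \int[mu]_s econv b (fun t => F (t, s)) x.
Proof.
move=> mF F0 nb; have [mb b0] := nb.
rewrite /econv.
transitivity (\int[mu]_y \int[mu]_s (b (x - y)%R * F (y, s))).
  apply: eq_integral => y _; rewrite ge0_integralZl//.
  by apply: (measurableT_comp mF); exact: measurable_fun_pair.
apply: (@tonelli (fun z => b (x - z.1)%R * F z)); last first.
  by move=> z; rewrite mule_ge0.
apply: emeasurable_funM => //.
by apply: (measurableT_comp mb); exact: measurable_funB.
Qed.

Definition causal (a : R -> \bar R) := forall x, (x <= 0)%R -> a x = 0.

Lemma causal_econv a b : causal a -> causal b -> causal (econv a b).
Proof.
move=> ca cb x x0; rewrite /econv integral0_eq// => y _.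
have [y0|y0] := leP y 0%R; first by rewrite cb// mule0.
by rewrite ca ?mul0e//; lra.
Qed.

(** Causal functions convolve over []0, x[] only. Identities known on a bounded interval, such as
    the Sonine identity on []0, 1]], can thus be substituted inside a convolution. *)
Lemma eq_econv a b a' b' x : causal a -> causal b -> causal a' -> causal b' ->
  (forall y, (0 < y < x)%R -> a y = a' y) ->
  (forall y, (0 < y < x)%R -> b y = b' y) ->
  econv a b x = econv a' b' x.
Proof.
move=> ca cb ca' cb' aa' bb'; apply: eq_integral => y _.
have [y0|y0] := leP y 0%R; first by rewrite cb// cb'// !mule0.
have [xy|xy] := leP x y; first by rewrite ca ?ca' ?mul0e//; lra.
by rewrite aa' ?bb' ?y0//; lra.
Qed.

Definition heaviside (x : R) : \bar R := if (0 < x)%R then 1 else 0.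

Lemma nnm_heaviside : nnm heaviside.
Proof.
split; last by move=> x; rewrite /heaviside; case: ifP.
apply: measurable_fun_ifT => //; apply: measurable_fun_ltr => //.
Qed.

Lemma causal_heaviside : causal heaviside.
Proof. by move=> x x0; rewrite /heaviside ltNge x0. Qed.

Lemma econv_heaviside (a : R -> \bar R) x :
  econv heaviside a x = \int[mu]_(y in `]-oo, x[) a y.
Proof.
rewrite integral_mkcond; apply: eq_integral => y _.
rewrite patchE /heaviside subr_gt0 mem_setE in_itv/=.
by case: ifP => _; rewrite ?mul1e ?mul0e.
Qed.

Lemma causal_econv_heaviside (a : R -> \bar R) x : causal a ->
  econv heaviside a x = \int[mu]_(y in `]0%R, x[) a y.
Proof.
move=> ca; rewrite econv_heaviside integral_mkcond [RHS]integral_mkcond.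
apply: eq_integral => y _; rewrite !patchE !mem_setE !in_itv/=.
by have [/ca->|//] := leP y 0%R; case: ifP.
Qed.

Lemma nd_econv_heaviside a x y : nnm a -> (x <= y)%R ->
  econv heaviside a x <= econv heaviside a y.
Proof.
move=> [ma a0] xy; rewrite !econv_heaviside; apply: ge0_subset_integral => //.
- exact: measurable_funTS.
- by apply: subset_itvl; rewrite bnd_simp.
Qed.

Lemma econv_dilate a b (c x : R) : (0 < c)%R -> nnm a -> nnm b ->
  econv (fun t => a (c * t)%R) (fun t => b (c * t)%R) x
  = (c^-1)%:E * econv a b (c * x)%R.
Proof.
move=> c0 na nb; rewrite /econv -integral_dilate//.
  by apply: eq_integral => y _; rewrite mulrBr.
exact: nnm_econv_integrand.
Qed.

Lemma nnm_dilate a (c : R) : nnm a -> nnm (fun t => a (c * t)%R).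
Proof. by move=> na; apply: nnm_comp => //; exact: measurable_funM. Qed.

Lemma causal_dilate a (c : R) : (0 < c)%R -> causal a ->
  causal (fun t => a (c * t)%R).
Proof. by move=> c0 ca x x0; apply: ca; rewrite pmulr_rle0. Qed.

End convolution.

(** * The Gamma kernel and its convolution semigroup *)

Section gamma_kernel.
Context {R : realType}.
Local Notation mu := (@lebesgue_measure R).

(** With the power written through [ln], products of powers and exponentials become sums of
    exponents. There is no division by [Gamma s], so that [s = 0] makes sense: it gives the density
    whose tail is [E1]. *)
Definition gker (s t : R) : R :=
  if 0 < t then expR ((s - 1) * ln t - t) else 0.

Lemma gker_ge0 s t : 0 <= gker s t.
Proof. by rewrite /gker; case: ifP => // _; exact: expR_ge0. Qed.

Lemma gkerE s t : 0 < t -> gker s t = t `^ (s - 1) * expR (- t).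
Proof. by move=> t0; rewrite /gker t0 expRD /powR gt_eqF. Qed.

Lemma measurable_gker : measurable_fun setT (fun z : R * R => gker z.1 z.2).
Proof.
apply: measurable_fun_ifT => //.
  exact: measurable_fun_ltr.
apply: measurableT_comp => //; apply: measurable_funB => //.
apply: measurable_funM; first exact: measurable_funB.
by apply: measurableT_comp.
Qed.

Definition egker (s t : R) : \bar R := (gker s t)%:E.

Lemma nnm_EFin (f : R -> R) : measurable_fun setT f -> (forall x, 0 <= f x) ->
  nnm (EFin \o f).
Proof. by move=> mf f0; split => [|x]; [exact/measurable_EFinP|rewrite lee_fin]. Qed.

Lemma nnm_egker s : nnm (egker s).
Proof.
apply: nnm_EFin => [|t]; last exact: gker_ge0.
by apply: (measurableT_comp measurable_gker (g := fun t => (s, t))); exact: measurable_fun_pair.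
Qed.

Lemma causal_egker s : causal (egker s).
Proof. by move=> t t0; rewrite /egker /gker ltNge t0. Qed.

Definition egamma (s : R) : \bar R := (\int[mu]_t egker s t)%E.

Lemma GammaE s : Gamma s = fine (egamma s).
Proof.
rewrite /Gamma /Rintegral; congr fine; rewrite integral_mkcond.
apply: eq_integral => t _; rewrite patchE mem_setE in_itv/= andbT /egker.
case: ifPn => t0; first by rewrite gkerE.
by rewrite /gker (negbTE t0).
Qed.

Lemma measurable_egamma : measurable_fun setT egamma.
Proof.
have [] // := @nnm_integral R (fun z => (gker z.1 z.2)%:E).
- by apply/measurable_EFinP; exact: measurable_gker.
- by move=> z; rewrite lee_fin gker_ge0.
Qed.

Lemma Gamma_ge0 (s : R) : 0 <= Gamma s.
Proof.
by rewrite GammaE fine_ge0//; apply: integral_ge0 => t _; rewrite lee_fin gker_ge0.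
Qed.

Lemma measurable_Gamma : measurable_fun setT (@Gamma R).
Proof.
have -> : @Gamma R = (fun s : R => fine (egamma s)).
  by apply/funext => s; rewrite GammaE.
by apply: measurableT_comp => //; exact: measurable_egamma.
Qed.

Lemma integral_expRN (c : R) : 0 < c ->
  (\int[mu]_(t in `[0%R, +oo[) (expR (- (c * t)))%:E = (c^-1)%:E)%E.
Proof.
move=> c0.
have := @integral_exponential_pdf R c c0.
rewrite (_ : (fun x => _) =
  (fun x => (c * expR (- c * x))%:E) \_ `[0%R, +oo[%classic)%E; last first.
  by apply/funext => x; rewrite /exponential_pdf !patchE; case: ifP.
rewrite -integral_mkcond/=.
under eq_integral do rewrite EFinM mulNr.
rewrite ge0_integralZl_EFin//; last 2 first.
- apply/measurable_EFinP/measurable_funTS; apply: measurableT_comp => //.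
  by apply: measurableT_comp => //; exact: measurable_funM.
- exact: ltW.
move=> h; have := congr1 (fun z => (c^-1)%:E * z)%E h.
by rewrite muleA -EFinM mulVf ?gt_eqF// mul1e mule1.
Qed.

(* The integrand is unbounded at [0] when [s < 1]: exhaust ]0, 1]. *)
Lemma integral_powR01 (s : R) : 0 < s ->
  (\int[mu]_(t in `]0%R, 1%R]) (t `^ (s - 1))%:E = (s^-1)%:E)%E.
Proof.
move=> s0.
(* [n.+2] rather than [n.+1] keeps every interval nondegenerate, as the fundamental theorem of
   calculus requires. *)
pose F (n : nat) : set R := `[n.+2%:R^-1, 1]%classic.
have UF : \bigcup_i F i = `]0%R, 1%R]%classic.
  apply/seteqP; split => t /=.
    move=> [n _]; rewrite /F/= !in_itv/= => /andP[h ->]; rewrite andbT.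
    by apply: lt_le_trans h; rewrite invr_gt0.
  rewrite in_itv/= => /andP[t0 t1].
  have tV : 0 <= t^-1 by rewrite invr_ge0 ltW.
  exists (Num.bound t^-1) => //; rewrite /F/= in_itv/= t1 andbT.
  rewrite invf_ple ?posrE// (le_trans (ltW (archi_boundP tV)))//.
  by rewrite ler_nat ltnW.
have IF n : (\int[mu]_(t in F n) (t `^ (s - 1))%:E
            = (s^-1 * (1 - n.+2%:R^-1 `^ s))%:E)%E.
  have n1 : (n.+2%:R^-1 : R) < 1 by rewrite invf_lt1// ltr1n.
  have n0 : 0 < (n.+2%:R^-1 : R) by rewrite invr_gt0.
  rewrite /F (@continuous_FTC2 _ _ (fun t => s^-1 * t `^ s))//.
  - rewrite powR1 -EFinB; congr (_%:E); ring.
  - apply: derivable_within_continuous => t; rewrite in_itv/= => /andP[nt _].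
    by apply: ex_derive; apply: is_derive1_powR; exact: lt_le_trans nt.
  - have dF t : 0 < t -> derivable (fun t => s^-1 * t `^ s) t 1.
      move=> t0; apply: derivableM => //.
      by apply: ex_derive; exact: is_derive1_powR.
    have cF t : 0 < t -> {for t, continuous (fun t => s^-1 * t `^ s)}.
      by move=> t0; apply: differentiable_continuous; apply/derivable1_diffP; exact: dF.
    split.
    + by move=> t; rewrite in_itv/= => /andP[h _]; apply: dF; exact: lt_trans h.
    + by apply: cvg_at_right_filter; exact: cF.
    + by apply: cvg_at_left_filter; exact: cF.
  - move=> t; rewrite in_itv/= => /andP[h _].
    have t0 : 0 < t by exact: lt_trans h.
    have dp := is_derive1_powR s t0.
    rewrite derive1E deriveM//.
    rewrite !derive_val scaler0 addr0 /GRing.scale/= mulrA mulVf ?mul1r//.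
    by rewrite gt_eqF.
have cv : (\int[mu]_(t in F n) (t `^ (s - 1))%:E @[n --> \oo] -->
  \int[mu]_(t in `]0%R, 1%R]) (t `^ (s - 1))%:E)%E.
  rewrite -UF; apply: ge0_nondecreasing_set_cvg_integral => //.
  - move=> m n mn; rewrite subsetEset; apply: subset_itvr; rewrite bnd_simp.
    by rewrite lef_pV2 ?posrE// ler_nat.
  - by move=> n; exact: measurable_itv.
  - by move=> n; apply: measurable_funTS; apply/measurable_EFinP; exact: measurable_powR.
  - by move=> n t _; rewrite lee_fin powR_ge0.
apply/esym; apply: (cvg_unique _ _ cv) => //.
rewrite (_ : (fun n => _) = (fun n => (s^-1 * (1 - n.+2%:R^-1 `^ s))%:E)); last first.
  by apply/funext => n; rewrite IF.
apply: cvg_EFin; first exact: nearW.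
have c1 : (n.+2%:R^-1 : R) `^ s @[n --> \oo] --> (0 : R).
  have := @powR_cvg0 R s s0 => /cvg_at_rightP; apply; split.
    by move=> n; rewrite invr_gt0.
  by rewrite (cvg_shiftS (@harmonic R)); exact: cvg_harmonic.
have := cvgM (cvg_cst s^-1) (cvgB (cvg_cst (1 : R)) c1).
by rewrite subr0 mulr1; apply.
Qed.

End gamma_kernel.

(** * Finiteness and size of the Gamma integral, semigroup law *)

Section gamma_kernel2.
Context {R : realType}.
Local Notation mu := (@lebesgue_measure R).
Lemma nnm_patch (D : set R) (f : R -> R) : measurable D ->
  measurable_fun D f -> (forall t, D t -> 0 <= f t) ->
  nnm ((fun t => (f t)%:E) \_ D).
Proof.
move=> mD mf f0; split.
  by apply/(measurable_restrictT _ _).1 => //; exact/measurable_EFinP.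
by move=> t; rewrite patchE; case: ifPn => // /set_mem Dt; rewrite lee_fin f0.
Qed.

Lemma measurable_expRN (c : R) : measurable_fun setT (fun t : R => expR (- (c * t))).
Proof.
apply: measurableT_comp => //; apply: measurableT_comp => //.
Qed.

Lemma nnm_expRN (c : R) : nnm ((fun t => (expR (- (c * t)))%:E) \_ `[0%R, +oo[%classic).
Proof.
apply: nnm_patch => //.
by apply: measurable_funTS; exact: measurable_expRN.
Qed.

Lemma nnm_powR01 (s : R) : nnm ((fun t : R => (t `^ s)%:E) \_ `]0%R, 1%R]%classic).
Proof.
apply: nnm_patch => //; last by move=> t _; exact: powR_ge0.
by apply: measurable_funTS; exact: measurable_powR.
Qed.

(** For [s <= 1] the integrand is at most [t^(s-1)] before 1 and at most [e^(-t)] after. Together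
    with [egamma_ge] this is the quantitative form of [Gamma(e) ~ 1/e]. *)
Lemma egamma_le (s : R) : 0 < s <= 1 -> (egamma s <= (s^-1 + 1)%:E)%E.
Proof.
move=> /andP[s0 s1].
rewrite EFinD -integral_powR01// -[X in (_ + X%:E)%E]invr1 -(integral_expRN ltr01).
rewrite [in leRHS]integral_mkcond [in X in (_ <= _ + X)%E]integral_mkcond.
have [[m1 p1] [m2 p2]] := (nnm_powR01 (s - 1), nnm_expRN 1).
have [mg g0] := nnm_egker s.
rewrite -ge0_integralD//; apply: ge0_le_integral => //.
  exact: emeasurable_funD.
move=> t _; rewrite !patchE !mem_setE !in_itv/= andbT /egker.
have [t0|t0] := leP t 0.
  rewrite /gker ltNge t0/=; case: ifP => _; last by rewrite add0e.
  by rewrite add0e lee_fin expR_ge0.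
rewrite (ltW t0) gkerE//= mul1r; case: ifPn => [t1|].
  rewrite /= -EFinD lee_fin -[leLHS]addr0 lerD ?expR_ge0// ler_piMr ?powR_ge0//.
  by rewrite expR_le1; lra.
rewrite -ltNge => t1; rewrite /= add0e lee_fin ler_piMl ?expR_ge0//.
rewrite /powR gt_eqF// expR_le1 mulr_le0_ge0//; first lra.
by rewrite ln_ge0// ltW.
Qed.

(** On []0, 1]], [e^(-t) >= 1 - t] gives the lower bound [1/s - 1/(s+1)]. The subtracted term is
    moved to the other side so that all integrands stay nonnegative. *)
Lemma egamma_ge (s : R) : 0 < s -> ((s^-1 - 1)%:E <= egamma s)%E.
Proof.
move=> s0; rewrite EFinB leeBlDr//.
have s10 : 0 < s + 1 by lra.
apply: (@le_trans _ _ (egamma s + ((s + 1)^-1)%:E)%E); last first.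
  by apply: leeD => //; rewrite lee_fin invf_le1//; lra.
rewrite -!integral_powR01// [leLHS]integral_mkcond [in X in (_ <= _ + X)%E]integral_mkcond.
have [[m1 p1] [m2 p2]] := (nnm_powR01 (s - 1), nnm_powR01 (s + 1 - 1)).
have [mg g0] := nnm_egker s.
rewrite -ge0_integralD//; apply: ge0_le_integral => //.
  exact: emeasurable_funD.
move=> t _; rewrite !patchE !mem_setE !in_itv/= /egker.
case: ifPn => [/andP[t0 t1]|_]; last by rewrite adde0 lee_fin gker_ge0.
rewrite gkerE// -EFinD lee_fin.
rewrite addrK -(mulr_powRB1 (ltW t0) s0).
have := expR_ge1Dx (- t); have := powR_ge0 t (s - 1).
nra.
Qed.

Lemma egamma_lty (s : R) : 0 < s -> (egamma s < +oo)%E.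
Proof.
move=> s0; have [s1|s1] := leP s 1.
  by apply: le_lt_trans (ltry _); apply: egamma_le; rewrite s0.
pose a := s - 1; have a0 : 0 < a by rewrite /a; lra.
(* [K] is the maximum of [a * ln t - t / 2], attained at [t = 2 * a]; half of the exponential decay
   is thus left for integrability. *)
pose K := a * ln (2 * a) - a.
have h : 0 < (2^-1 : R) by lra.
apply: (@le_lt_trans _ _ ((expR K)%:E * (2^-1^-1)%:E)%E); last by rewrite -EFinM ltry.
rewrite -(integral_expRN h) integral_mkcond.
have [m p] := nnm_expRN 2^-1; have [mg g0] := nnm_egker s.
rewrite -ge0_integralZl//.
apply: ge0_le_integral => //.
  by apply: emeasurable_funM.
move=> t _; rewrite !patchE !mem_setE !in_itv/= /egker andbT.
have [t0|t0] := leP t 0.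
  rewrite /gker ltNge t0/=; case: ifP => _; last by rewrite mule0.
  by rewrite -EFinM lee_fin mulr_ge0// expR_ge0.
rewrite (ltW t0) -EFinM lee_fin -expRD /gker t0 ler_expR -/a /K.
have ta : 0 < t / (2 * a) by rewrite divr_gt0//; lra.
have : ln (1 + (t / (2 * a) - 1)) <= t / (2 * a) - 1 by apply: le_ln1Dx; lra.
rewrite addrC subrK ln_div ?posrE//; last by lra.
rewrite -(ler_pM2l a0).
rewrite (_ : a * (t / (2 * a) - 1) = t / 2 - a); last by field; lra.
lra.
Qed.

Lemma egamma_fineK (s : R) : 0 < s -> egamma s = (Gamma s)%:E.
Proof.
move=> s0; rewrite GammaE fineK// ge0_fin_numE ?egamma_lty//.
by apply: integral_ge0 => t _; rewrite lee_fin gker_ge0.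
Qed.

Lemma Gamma_gt0 (s : R) : 0 < s -> 0 < Gamma s.
Proof.
move=> s0; rewrite -lte_fin -egamma_fineK//.
apply: (@lt_le_trans _ _ ((expR (- 1))%:E * (s^-1)%:E)%E).
  by rewrite -EFinM lte_fin mulr_gt0 ?expR_gt0// invr_gt0.
rewrite -integral_powR01// integral_mkcond.
have [m p] := nnm_powR01 (s - 1); have [mg g0] := nnm_egker s.
rewrite -ge0_integralZl//.
apply: ge0_le_integral => //.
- by move=> t _; rewrite mule_ge0// lee_fin expR_ge0.
- by apply: emeasurable_funM.
move=> t _; rewrite !patchE !mem_setE !in_itv/= /egker.
case: ifPn => [/andP[t0 t1]|_]; last by rewrite mule0 lee_fin gker_ge0.
rewrite gkerE// -EFinM lee_fin mulrC ler_wpM2l ?powR_ge0// ler_expR; lra.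
Qed.

(** Scaling shows that the convolution is a constant multiple of [egker (s + r)]. The constant then
    comes from integrating both sides over the line, so that no Beta integral is computed. *)
Lemma econv_egker (s r : R) : 0 < s -> 0 < r ->
  econv (egker s) (egker r) =
  (fun x => ((Gamma s * Gamma r / Gamma (s + r))%:E * egker (s + r) x)%E).
Proof.
move=> s0 r0; have sr0 : 0 < s + r by lra.
pose B := econv (egker s) (egker r) 1.
have B0 : (0 <= B)%E by exact: (nnm_econv (nnm_egker s) (nnm_egker r)).2.
have e1 : (0 <= (expR 1 : R)%:E)%E by rewrite lee_fin expR_ge0.
have H : econv (egker s) (egker r) = (fun x => ((expR 1)%:E * B * egker (s + r) x)%E).
  apply/funext => x; have [x0|x0] := leP x 0.
    by rewrite causal_econv ?causal_egker ?mule0//; exact: causal_egker.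
  have := econv_dilate 1 x0 (nnm_egker s) (nnm_egker r); rewrite mulr1.
  move=> /(congr1 (fun z => x%:E * z)%E); rewrite muleA -EFinM mulfV ?gt_eqF// mul1e => <-.
  (* Dilation by [x] multiplies the integrand at the point 1 by [x^(s+r-2)], and changes its
     exponential factor from [e^(-1)] to [e^(-x)]. *)
  pose E := expR ((s + r - 2) * ln x + 1 - x).
  have -> : econv (fun t => egker s (x * t)) (fun t => egker r (x * t)) 1 =
    (E%:E * B)%E.
    rewrite /B /econv -ge0_integralZl//; last 3 first.
    - by case: (nnm_econv_integrand 1 (nnm_egker s) (nnm_egker r)).
    - by move=> y _; case: (nnm_econv_integrand 1 (nnm_egker s) (nnm_egker r)).
    - by rewrite lee_fin expR_ge0.
    apply: eq_integral => y _; rewrite /egker -!EFinM /gker !pmulr_rgt0//.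
    congr (_%:E); case: ifPn => [y1|]; last by rewrite !mul0r mulr0.
    case: ifPn => [y0|]; last by rewrite !mulr0.
    rewrite /E -!expRD !lnM ?posrE//; congr expR; ring.
  rewrite muleA [in RHS]muleAC; congr (_ * B)%E.
  rewrite /egker /gker x0 -!EFinM; congr (_%:E).
  rewrite -[X in X * E](lnK (x := x)) ?posrE//= -!expRD; congr expR; ring.
have := integral_econv (nnm_egker s) (nnm_egker r).
have [mg g0] := nnm_egker (s + r).
rewrite H ge0_integralZl// ?mule_ge0//.
rewrite -/(egamma s) -/(egamma r) -/(egamma (s + r)) !egamma_fineK//.
move: ((expR 1)%:E * B)%E => X XE; apply/funext => x.
have -> : X = (Gamma s * Gamma r / Gamma (s + r))%:E; last by [].
by rewrite EFinM [in RHS]EFinM -XE -muleA -EFinM mulfV ?mule1 ?gt_eqF ?Gamma_gt0.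
Qed.

(** Vanishing for [s <= 0] lets integrals over [s] run over the whole line, where the parameter can
    be translated. *)
Definition pker (s t : R) : R := if 0 < s then gker s t / Gamma s else 0.

Definition epker (s t : R) : \bar R := (pker s t)%:E.

Lemma pker_ge0 s t : 0 <= pker s t.
Proof. by rewrite /pker; case: ifP => // _; rewrite divr_ge0 ?gker_ge0 ?Gamma_ge0. Qed.

Lemma measurable_pker : measurable_fun setT (fun z : R * R => pker z.1 z.2).
Proof.
apply: measurable_fun_ifT => //; first exact: measurable_fun_ltr.
apply: measurable_funM; first exact: measurable_gker.
have -> : (fun z : R * R => (Gamma z.1)^-1) = (fun z => Gamma z.1 `^ (- 1)).
  by apply/funext => z; rewrite powR_inv1// Gamma_ge0.
apply: (measurableT_comp (measurable_powR _)).
by apply: (measurableT_comp measurable_Gamma).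
Qed.

Lemma nnm_epker s : nnm (epker s).
Proof.
apply: nnm_EFin => [|t]; last exact: pker_ge0.
by apply: (measurableT_comp measurable_pker (g := fun t => (s, t))); exact: measurable_fun_pair.
Qed.

Lemma causal_epker s : causal (epker s).
Proof. by move=> t t0; rewrite /epker /pker /gker [0 < t]ltNge t0 mul0r; case: ifP. Qed.

Lemma epkerE (s : R) : 0 < s -> epker s = (fun t => ((Gamma s)^-1%:E * egker s t)%E).
Proof. by move=> s0; apply/funext => t; rewrite /epker /pker s0 mulrC EFinM. Qed.

Lemma egkerE (s : R) : 0 < s -> egker s = (fun t => ((Gamma s)%:E * epker s t)%E).
Proof.
move=> s0; apply/funext => t.
by rewrite epkerE// [RHS]muleA -[X in (X * _)%E]EFinM mulfV ?gt_eqF ?Gamma_gt0// mul1e.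
Qed.

Lemma econv_epker (s r : R) : 0 < s -> 0 < r ->
  econv (epker s) (epker r) = epker (s + r).
Proof.
move=> s0 r0; have sr0 : 0 < s + r by lra.
have [Gs [Gr Gsr]] := (Gamma_gt0 s0, (Gamma_gt0 r0, Gamma_gt0 sr0)).
have i0 (x : R) : (0 <= (Gamma x)^-1%:E)%E by rewrite lee_fin invr_ge0 Gamma_ge0.
rewrite (epkerE s0) (epkerE r0) econvZl//; [|exact: nnm_egker|]; last first.
  by apply: nnm_scale => //; exact: nnm_egker.
rewrite econvZr//; [|exact: nnm_egker|exact: nnm_egker].
rewrite econv_egker// epkerE//; apply/funext => x.
have E (a b c : R) : 0 < a -> 0 < b -> a^-1 * b^-1 * (a * b / c) = c^-1.
  move=> a0 b0; rewrite -invfM mulrA mulVf ?mul1r//.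
  by rewrite mulf_neq0// gt_eqF.
by rewrite !muleA -!EFinM E.
Qed.

Lemma integral_epker (s : R) : 0 < s -> (\int[mu]_t epker s t = 1)%E.
Proof.
move=> s0; rewrite epkerE//; have [mg g0] := nnm_egker s.
rewrite ge0_integralZl// ?lee_fin ?invr_ge0 ?Gamma_ge0//.
by rewrite -/(egamma s) egamma_fineK// -EFinM mulVf// gt_eqF// Gamma_gt0.
Qed.

End gamma_kernel2.

(** * The Sonine identity E1 * S = 1 *)

Section volterra_kernel.
Context {R : realType}.
Local Open Scope ereal_scope.
Local Notation mu := (@lebesgue_measure R).

Definition eS (t : R) : \bar R := \int[mu]_s epker s t.

Lemma measurable_epker2 : measurable_fun setT (fun z : R * R => epker z.2 z.1).
Proof.
apply/measurable_EFinP.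
by apply: (measurableT_comp measurable_pker (g := fun z => (z.2, z.1))); exact: measurable_fun_pair.
Qed.

Lemma nnm_eS : nnm eS.
Proof.
apply: (@nnm_integral R (fun z => epker z.2 z.1)); first exact: measurable_epker2.
by move=> z; rewrite lee_fin pker_ge0.
Qed.

Lemma causal_eS : causal eS.
Proof. by move=> t t0; apply: integral0_eq => s _; exact: causal_epker. Qed.

Definition eP (s x : R) : \bar R := econv heaviside (epker s) x.

Lemma econv_eS (b : R -> \bar R) x : nnm b ->
  econv b eS x = \int[mu]_s econv b (epker s) x.
Proof.
move=> nb; apply: (@econv_integral_param R (fun z => epker z.2 z.1)) => //.
  exact: measurable_epker2.
by move=> z; rewrite lee_fin pker_ge0.
Qed.

(** [E1] is [tail (egker 0)]. The factors [heaviside] make the tail causal and turn the moving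
    domain of integration into a jointly measurable integrand, ready for Tonelli. *)
Definition tail (k : R -> \bar R) (t : R) : \bar R :=
  heaviside t * \int[mu]_r (heaviside (r - t)%R * k r).

Lemma measurable_tail_integrand (k : R -> \bar R) : nnm k ->
  measurable_fun setT (fun z : R * R => heaviside (z.2 - z.1)%R * k z.2).
Proof.
move=> [mk k0]; apply: emeasurable_funM.
  apply: (measurableT_comp (@nnm_heaviside R).1); exact: measurable_funB.
exact: (measurableT_comp mk).
Qed.

Lemma heaviside_ge0 (x : R) : 0 <= heaviside x.
Proof. exact: (@nnm_heaviside R).2. Qed.

Lemma nnm_tail (k : R -> \bar R) : nnm k -> nnm (tail k).
Proof.
move=> nk; apply: nnm_mul; first exact: nnm_heaviside.
apply: (@nnm_integral R (fun z => heaviside (z.2 - z.1)%R * k z.2)).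
  exact: measurable_tail_integrand.
by move=> z; rewrite mule_ge0 ?heaviside_ge0//; exact: nk.2.
Qed.

Lemma causal_tail (k : R -> \bar R) : causal (tail k).
Proof. by move=> t t0; rewrite /tail causal_heaviside// mul0e. Qed.

Lemma nnm_tail_integrand (k : R -> \bar R) t : nnm k -> nnm (fun r => heaviside (r - t)%R * k r).
Proof.
move=> nk; apply: nnm_mul => //; apply: nnm_comp; first exact: nnm_heaviside.
exact: measurable_funB.
Qed.

Lemma le_tail (k k' : R -> \bar R) t : nnm k -> nnm k' ->
  (forall r, (t < r)%R -> k r <= k' r) -> tail k t <= tail k' t.
Proof.
move=> nk nk' kk'; apply: lee_wpmul2l; first exact: heaviside_ge0.
have [m p] := nnm_tail_integrand t nk; have [m' p'] := nnm_tail_integrand t nk'.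
apply: ge0_le_integral => // r _; rewrite /heaviside subr_gt0.
by case: ifPn => [tr|_]; rewrite ?mul1e ?mul0e//; exact: kk'.
Qed.

Lemma tailE (k : R -> \bar R) t : (0 < t)%R -> tail k t = \int[mu]_(r in `]t, +oo[) k r.
Proof.
move=> t0; rewrite /tail /heaviside t0 mul1e [RHS]integral_mkcond.
apply: eq_integral => r _; rewrite patchE mem_setE in_itv/= andbT subr_gt0.
by case: ifP; rewrite ?mul1e ?mul0e.
Qed.

(** The identity is additive because a difference of extended reals may be meaningless. For
    [k = egker e] the total mass is [Gamma e]. *)
Lemma tail_add (k : R -> \bar R) t : nnm k -> causal k ->
  tail k t + econv heaviside k t = (\int[mu]_r k r) * heaviside t.
Proof.
move=> nk ck; have [t0|t0] := leP t 0%R.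
  rewrite causal_tail// causal_econv//; last exact: causal_heaviside.
  by rewrite add0e causal_heaviside// mule0.
have [mk k0] := nk.
rewrite tailE// econv_heaviside /heaviside t0 mule1.
rewrite integral_itv_bndo_bndc; last exact: measurable_funTS.
rewrite -[in RHS](setUv `]-oo, t]%classic) ge0_integral_setU//.
- by rewrite setCitvl addeC.
- exact: measurableC.
- by rewrite setUv.
- exact/disj_setPCl.
Qed.

Lemma eP_ge0 s x : 0 <= eP s x.
Proof. exact: (nnm_econv nnm_heaviside (nnm_epker s)).2. Qed.

Lemma nnm_eP x : nnm (eP ^~ x).
Proof.
apply: (@nnm_integral R (fun z : R * R => heaviside (x - z.2)%R * epker z.1 z.2)).
  apply: emeasurable_funM.
    by apply: (measurableT_comp (@nnm_heaviside R).1); exact: measurable_funB.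
  by apply/measurable_EFinP; exact: measurable_pker.
by move=> z; rewrite mule_ge0 ?heaviside_ge0// lee_fin pker_ge0.
Qed.

Lemma eP_le1 s x : (0 < s)%R -> eP s x <= 1.
Proof.
move=> s0; rewrite -(integral_epker s0) /eP econv_heaviside.
have [m p] := nnm_epker s.
by apply: ge0_subset_integral.
Qed.

(** [r^(s-1)] is at most 1 for [r >= 1], and at most [1/r < 1/x] for [r < 1], so the constant does
    not depend on [s]. *)
Lemma gker_tail_le (s x r : R) : (0 < s <= 1)%R -> (0 < x)%R -> (x < r)%R ->
  (gker s r <= (1 + x^-1) * expR (- r))%R.
Proof.
move=> /andP[s0 s1] x0 xr; have r0 : (0 < r)%R by exact: lt_trans xr.
rewrite gkerE// ler_wpM2r ?expR_ge0//.
have x1 : (0 < x^-1)%R by rewrite invr_gt0.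
have [r1|r1] := leP 1%R r.
  apply: (@le_trans _ _ 1%R); last lra.
  rewrite /powR gt_eqF// expR_le1 mulr_le0_ge0//; first lra.
  exact: ln_ge0.
apply: (@le_trans _ _ (r^-1)%R).
  rewrite /powR gt_eqF// -[leRHS](lnK (x := (r^-1)%R)) ?posrE ?invr_gt0//.
  rewrite ler_expR lnV ?posrE//.
  have : (ln r < 0)%R by apply: ln_lt0; rewrite r0.
  nra.
have : (r^-1 <= x^-1)%R by rewrite lef_pV2 ?posrE// ltW.
lra.
Qed.

(** The mass missing beyond [x] is a tail integral bounded uniformly in [s], divided by [Gamma s],
    which is of order [1/s]. *)
Lemma eP_ge s x : (0 < s <= 2^-1)%R -> (0 < x)%R ->
  (1 - 2 * (1 + x^-1) * s)%:E <= eP s x.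
Proof.
move=> /andP[s0 s1] x0.
have xi : (0 < x^-1)%R by rewrite invr_gt0.
have := tail_add x (nnm_epker s) (@causal_epker _ s).
rewrite integral_epker// mul1e {2}/heaviside x0 -/(eP s x) => h.
rewrite EFinB leeBlDr// -h addeC leeD2l// tailE//.
have [mk k0] := nnm_epker s.
have C0 : (0 <= 2 * s * (1 + x^-1))%R by rewrite mulr_ge0//; lra.
have G0 : (0 < Gamma s)%R by exact: Gamma_gt0.
(* For [s <= 1/2], [Gamma s >= 1/s - 1 >= 1/(2 * s)]: this is the origin of the factor 2 in the
   statement. *)
have Gi : ((Gamma s)^-1 <= 2 * s)%R.
  have := egamma_ge s0; rewrite egamma_fineK// lee_fin => h1.
  rewrite -[leRHS]invrK lef_pV2 ?posrE ?invr_gt0//; last lra.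
  apply: le_trans h1; rewrite invfM.
  have : (2 <= s^-1)%R by rewrite -[leLHS]invrK lef_pV2 ?posrE// invr_gt0.
  lra.
pose F := (fun t : R => (expR (- (1 * t)))%:E) \_ `[0%R, +oo[%classic.
apply: (@le_trans _ _ (\int[mu]_r ((2 * s * (1 + x^-1))%:E * F r))); last first.
  have [mF F0] := nnm_expRN (1 : R).
  rewrite ge0_integralZl// -integral_mkcond integral_expRN// invr1 mule1 lee_fin.
  by rewrite mulrAC.
have [mF F0] := nnm_scale (c := (2 * s * (1 + x^-1))%:E) C0 (nnm_expRN (1 : R)).
rewrite integral_mkcond; apply: ge0_le_integral => //.
- by move=> r _; rewrite patchE; case: ifP.
- by apply/(measurable_restrictT _ _).1 => //; exact: measurable_funTS.
move=> r _; rewrite patchE mem_setE in_itv/= andbT; case: ifPn => xr; last exact: F0.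
rewrite /F patchE mem_setE in_itv/= andbT (ltW (lt_trans x0 xr)) -EFinM lee_fin.
rewrite /pker s0 mul1r [leLHS]mulrC -[leRHS]mulrA; apply: ler_pM => //.
- by rewrite invr_ge0 ltW.
- exact: gker_ge0.
- by apply: gker_tail_le => //; rewrite s0/=; lra.
Qed.

Lemma integral_eP_le (e x : R) : (0 < e)%R ->
  \int[mu]_(s in `]0%R, e]) eP s x <= e%:E.
Proof.
move=> e0; have [m p] := nnm_eP x.
apply: (@le_trans _ _ (\int[mu]_(s in `]0%R, e]) 1)).
  apply: ge0_le_integral => //; first exact: measurable_funTS.
  by move=> s; rewrite /= in_itv/= => /andP[s0 _]; exact: eP_le1.
by rewrite integral_cst//= lebesgue_measure_itv/= lte_fin e0 mul1e oppr0 adde0.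
Qed.

Lemma integral_eP_ge (e x : R) : (0 < e <= 2^-1)%R -> (0 < x)%R ->
  (2 * (1 + x^-1) * e <= 1)%R ->
  ((1 - 2 * (1 + x^-1) * e) * e)%:E <= \int[mu]_(s in `]0%R, e]) eP s x.
Proof.
move=> /andP[e0 e1] x0 Ce; have [m p] := nnm_eP x.
have xi : (0 < x^-1)%R by rewrite invr_gt0.
apply: (@le_trans _ _ (\int[mu]_(s in `]0%R, e]) (1 - 2 * (1 + x^-1) * e)%:E)).
  by rewrite integral_cst//= lebesgue_measure_itv/= lte_fin e0 EFinM oppr0 adde0.
apply: ge0_le_integral => //.
- by move=> s _; rewrite lee_fin; lra.
- exact: measurable_funTS.
- move=> s; rewrite /= in_itv/= => /andP[s0 se].
  apply: le_trans (eP_ge _ x0); last by rewrite s0; lra.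
  by rewrite lee_fin lerD2l lerN2 ler_wpM2l// mulr_ge0//; lra.
Qed.

Definition upper_part (e : R) (z : R * R) : \bar R :=
  if (e < z.2)%R then epker z.2 z.1 else 0.

Definition lower_part (e : R) (z : R * R) : \bar R :=
  if (z.2 <= e)%R then epker z.2 z.1 else 0.

Lemma epker_ge0 (s t : R) : 0 <= epker s t.
Proof. by rewrite lee_fin pker_ge0. Qed.

Lemma measurable_upper_part e : measurable_fun setT (upper_part e).
Proof.
apply: measurable_fun_ifT => //; last exact: measurable_epker2.
exact: measurable_fun_ltr.
Qed.

Lemma measurable_lower_part e : measurable_fun setT (lower_part e).
Proof.
apply: measurable_fun_ifT => //; last exact: measurable_epker2.
exact: measurable_fun_ler.
Qed.

Lemma upper_part_ge0 e z : 0 <= upper_part e z.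
Proof. by rewrite /upper_part; case: ifP => // _; exact: epker_ge0. Qed.

Lemma lower_part_ge0 e z : 0 <= lower_part e z.
Proof. by rewrite /lower_part; case: ifP => // _; exact: epker_ge0. Qed.

Definition eS_upper (e t : R) : \bar R := \int[mu]_s upper_part e (t, s).

Definition eS_lower (e t : R) : \bar R := \int[mu]_s lower_part e (t, s).

Lemma nnm_section (F : R * R -> \bar R) t : measurable_fun setT F ->
  (forall z, 0 <= F z) -> nnm (fun s => F (t, s)).
Proof.
by move=> mF F0; split => //; apply: (measurableT_comp mF); exact: measurable_fun_pair.
Qed.

Lemma nnm_eS_upper e : nnm (eS_upper e).
Proof.
by apply: nnm_integral; [exact: measurable_upper_part|exact: upper_part_ge0].
Qed.

Lemma nnm_eS_lower e : nnm (eS_lower e).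
Proof.
by apply: nnm_integral; [exact: measurable_lower_part|exact: lower_part_ge0].
Qed.

Lemma eS_splitE e : eS = (fun t => eS_upper e t + eS_lower e t).
Proof.
apply/funext => t; rewrite /eS_upper /eS_lower.
have [mu' pu] := nnm_section t (@measurable_upper_part e) (upper_part_ge0 e).
have [ml pl] := nnm_section t (@measurable_lower_part e) (lower_part_ge0 e).
rewrite -ge0_integralD//; apply: eq_integral => s _.
rewrite /upper_part /lower_part/=.
by have [se|se] := leP s e; rewrite ?add0e ?adde0.
Qed.

(** Convolution with [p_e] adds [e] to the parameter; translating the integration variable [s] by
    [e] then turns the range [s > 0] into [s > e]. *)
Lemma econv_epker_eS (e : R) : (0 < e)%R -> econv (epker e) eS = eS_upper e.
Proof.
move=> e0; apply/funext => t; rewrite econv_eS; last exact: nnm_epker.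
rewrite /eS_upper.
rewrite -(@integral_shift _ (- e)%R (fun s => upper_part e (t, s))); last first.
  by apply: nnm_section; [exact: measurable_upper_part|exact: upper_part_ge0].
apply: eq_integral => s _; rewrite /upper_part/= opprK.
have [s0|s0] := leP s 0%R.
  rewrite ifF; last by apply/negbTE; rewrite -leNgt; lra.
  apply: integral0_eq => y _.
  by rewrite /epker /pker [(0 < s)%R]ltNge s0 mule0.
rewrite ltrDr s0 econv_epker; [|exact: e0|exact: s0].
by rewrite [(e + s)%R]addrC.
Qed.

Lemma econv_heaviside_eS_lower (e x : R) :
  econv heaviside (eS_lower e) x = \int[mu]_(s in `]0%R, e]) eP s x.
Proof.
rewrite /eS_lower (@econv_integral_param R (lower_part e)); last 3 first.
- exact: measurable_lower_part.
- exact: lower_part_ge0.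
- exact: nnm_heaviside.
rewrite [RHS]integral_mkcond.
apply: eq_integral => s _; rewrite patchE mem_setE in_itv/= /lower_part/=.
have [s0|s0]/= := leP s 0%R.
  apply: integral0_eq => y _; case: ifP => _; last by rewrite mule0.
  by rewrite /epker /pker [(0 < s)%R]ltNge s0/= mule0.
by case: ifPn => // _; apply: integral0_eq => y _; rewrite mule0.
Qed.

(* [tail (egker e) = Gamma e (heaviside - heaviside * p_e)], so its convolution
   with [S = \int_0^oo p_s ds] telescopes. *)
Lemma econv_tail_egker (e x : R) : (0 < e)%R -> econv heaviside eS x < +oo ->
  econv (tail (egker e)) eS x
  = (Gamma e)%:E * \int[mu]_(s in `]0%R, e]) eP s x.
Proof.
move=> e0 HS.
have nH := @nnm_heaviside R; have nS := nnm_eS; have ng := nnm_egker e.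
have np := nnm_epker e; have nt := nnm_tail ng.
have nHg := nnm_econv nH ng; have nHp := nnm_econv nH np.
have nU := nnm_eS_upper e; have nL := nnm_eS_lower e.
have G0 : 0 <= (Gamma e)%:E by rewrite lee_fin Gamma_ge0.
have HgE : econv heaviside (egker e) = (fun t => (Gamma e)%:E * econv heaviside (epker e) t).
  by rewrite egkerE// econvZr.
(* Both sides equal [Gamma e] times [H * S] at [x]. The common last term is cancelled only once [HS]
   has shown it to be finite. *)
have key : econv (tail (egker e)) eS x + (Gamma e)%:E * econv heaviside (eS_upper e) x
   = (Gamma e)%:E * econv heaviside (eS_lower e) x
     + (Gamma e)%:E * econv heaviside (eS_upper e) x.
  transitivity ((Gamma e)%:E * econv heaviside eS x); last first.
    rewrite (eS_splitE e) (econvDr nH nU nL) ge0_muleDr.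
    - exact: addeC.
    - exact: (nnm_econv nH nU).2.
    - exact: (nnm_econv nH nL).2.
  transitivity (econv (fun t => tail (egker e) t + econv heaviside (egker e) t) eS x).
    rewrite (econvDl nt nHg nS); congr (_ + _).
    by rewrite HgE (econvZl G0 nHp nS) (econvA nH np nS) (econv_epker_eS e0).
  have -> : (fun t => tail (egker e) t + econv heaviside (egker e) t) =
            (fun t => (Gamma e)%:E * heaviside t).
    apply/funext => t.
    by rewrite (tail_add t ng (@causal_egker _ e)) -/(egamma e) (egamma_fineK e0).
  by rewrite (econvZl G0 nH nS).
have HU0 := (nnm_econv nH nU).2 x.
have HU : econv heaviside (eS_upper e) x < +oo.
  apply: le_lt_trans HS; apply: le_econv => // t.
  by rewrite (eS_splitE e) leeDl// nL.2.
have fin : (Gamma e)%:E * econv heaviside (eS_upper e) x \is a fin_num.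
  by rewrite fin_numM// ge0_fin_numE.
move/(congr1 (fun z => z - (Gamma e)%:E * econv heaviside (eS_upper e) x)): key.
by rewrite (addeK _ fin) (addeK _ fin) econv_heaviside_eS_lower.
Qed.

(** Convexity of the exponential between [0] and [ln r] gives [r^e <= 1 - e + e * r]; it remains to
    multiply by [r^(-1) e^(-r)]. *)
Lemma egker_le (e r : R) : (0 < e <= 1)%R ->
  egker e r <= egker 0 r
    + e%:E * ((fun t => (expR (- (1 * t)))%:E) \_ `[0%R, +oo[%classic) r.
Proof.
move=> /andP[e0 e1]; rewrite patchE mem_setE in_itv/= andbT.
have [r0|r0] := leP r 0%R.
  rewrite (@causal_egker R e r r0) (@causal_egker R 0%R r r0) add0e.
  by case: ifP => _; rewrite ?mule0// -EFinM lee_fin mulr_ge0 ?expR_ge0// ltW.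
rewrite (ltW r0) /egker -EFinM -EFinD lee_fin !gkerE// mul1r -mulrDl.
rewrite ler_wpM2r ?expR_ge0// sub0r -(ler_pM2l r0) (mulr_powRB1 (ltW r0) e0).
rewrite (powR_inv1 (ltW r0)) mulrDr mulfV ?gt_eqF//.
have := @convex_expR R (Itv01 (ltW e0) e1) (ln r) 0%R.
rewrite !convRE/= mulr0 addr0 expR0 mulr1 lnK ?posrE//.
by rewrite /powR gt_eqF// /unstable.onem; lra.
Qed.

Lemma econv_E1_ge (x : R) : (0 < x)%R -> econv heaviside eS x < +oo ->
  1 <= econv (tail (egker 0)) eS x.
Proof.
move=> x0 HS; have nS := nnm_eS; have nH := @nnm_heaviside R.
have [h hE] : exists h : R, econv heaviside eS x = h%:E.
  exists (fine (econv heaviside eS x)); rewrite fineK// ge0_fin_numE//.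
  exact: (nnm_econv nH nS).2.
have h0 : (0 <= h)%R by rewrite -lee_fin -hE (nnm_econv nH nS).2.
have xi : (0 < x^-1)%R by rewrite invr_gt0.
pose C := (2 * (1 + x^-1))%R.
have C0 : (0 < C)%R by rewrite /C; lra.
have n0 := nnm_tail (nnm_egker (0 : R)).
apply/lee_addgt0Pr => d d0.
(* The first two bounds make [integral_eP_ge] applicable; the third absorbs into [d] the errors
   [(1 + C) * e] of [L1] and [e * h] of [L2]. *)
pose e : R := Num.min (2^-1)%R (Num.min C^-1 (d / (1 + C + h)))%R.
have Ch : (0 < 1 + C + h)%R by lra.
have e0 : (0 < e)%R by rewrite !lt_min !invr_gt0 C0 ltr0n/= divr_gt0.
have e2 : (e <= 2^-1)%R by rewrite ge_min lexx.
have eC : (C * e <= 1)%R.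
  by rewrite mulrC -ler_pdivlMr// div1r 2!ge_min lexx orbT.
have ed : (e * (1 + C + h) <= d)%R.
  by rewrite -ler_pdivlMr// 2!ge_min lexx !orbT.
have e01 : (0 < e <= 2^-1)%R by rewrite e0.
(* Product of [Gamma e >= 1/e - 1] with the lower bound [(1 - C * e) * e] for the integral of [eP];
   the positive term [C * e^2] is dropped. *)
have L1 : ((1 - (1 + C) * e)%:E <= econv (tail (egker e)) eS x).
  rewrite econv_tail_egker//.
  apply: (@le_trans _ _ ((e^-1 - 1)%:E * ((1 - C * e) * e)%:E)).
    have Cee : (0 <= C * e * e)%R by exact: (mulr_ge0 (mulr_ge0 (ltW C0) (ltW e0)) (ltW e0)).
    rewrite -EFinM lee_fin [leRHS]mulrA [leRHS]mulrAC [in leRHS]mulrBl mulVf ?gt_eqF// mul1r.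
      lra.
  apply: lee_pmul.
  - by rewrite lee_fin subr_ge0 invf_ge1// (le_trans e2)//; lra.
  - by rewrite lee_fin mulr_ge0 ?subr_ge0 ?(ltW e0).
  - by rewrite -egamma_fineK// egamma_ge.
  - exact: integral_eP_ge.
pose E := (fun t : R => (expR (- (1 * t)))%:E) \_ `[0%R, +oo[%classic.
have nE : nnm E by exact: nnm_expRN.
have ee : 0 <= e%:E by rewrite lee_fin ltW.
have neE := nnm_scale ee nE.
have ngE := nnm_add (nnm_egker (0 : R)) neE.
have neH := nnm_scale ee nH.
(* The error term of [egker_le] has tails at most [e]; convolved with [S] it costs at most [e] times
   [H * S] at [x], that is [e * h]. *)
have L2 : econv (tail (egker e)) eS x <= econv (tail (egker 0)) eS x + (e * h)%:E.
  rewrite EFinM -hE.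
  have -> : e%:E * econv heaviside eS x = econv (fun t => e%:E * heaviside t) eS x.
    by rewrite (econvZl ee nH nS).
  have := econvDl n0 neH nS; move/(congr1 (fun F => F x)) => <-.
  have nt := nnm_tail (nnm_egker e).
  apply: (le_econv x nt nS (nnm_add n0 neH) nS) => // t.
  have [t0|t0] := leP t 0%R.
    by rewrite !causal_tail// causal_heaviside// mule0 adde0.
  apply: (@le_trans _ _ (tail (fun r => egker 0 r + e%:E * E r) t)).
    apply: (le_tail (nnm_egker e) ngE) => r _; apply: egker_le; rewrite e0/=; lra.
  have [m1 p1] := nnm_egker (0 : R); have [m2 p2] := neE; have [mE pE] := nE.
  rewrite !tailE// ge0_integralD//; last 2 first.
  - exact: measurable_funTS.
  - exact: measurable_funTS.
  apply: leeD2l; rewrite ge0_integralZl//; last exact: measurable_funTS.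
  rewrite /heaviside t0; apply: lee_wpmul2l => //.
  apply: (@le_trans _ _ (\int[mu]_r E r)); first exact: ge0_subset_integral.
  by rewrite -integral_mkcond integral_expRN// invr1.
apply: (@le_trans _ _ ((1 - (1 + C) * e)%:E + (e * (1 + C))%:E)).
  by rewrite -EFinD lee_fin; lra.
apply: (@le_trans _ _ (econv (tail (egker 0)) eS x + (e * h)%:E + (e * (1 + C))%:E)).
  by apply: leeD2r; exact: le_trans L2.
rewrite -addeA leeD2l// -EFinD lee_fin; lra.
Qed.

(** Beyond a cut-off [n > 0] one has [r^e >= 1 + e * ln n], which tends to 1 with [e] uniformly in
    [r]. No such bound survives near [r = 0], hence the truncation. *)
Definition etrunc (n : R) (r : R) : \bar R := if (n < r)%R then egker 0 r else 0.

Lemma nnm_etrunc n : nnm (etrunc n).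
Proof.
split; last by move=> r; rewrite /etrunc; case: ifP => // _; rewrite lee_fin gker_ge0.
apply: measurable_fun_ifT => //; last exact: (nnm_egker 0%R).1.
exact: measurable_fun_ltr.
Qed.

Lemma etrunc_le (e n r : R) : (0 < e)%R -> (0 < n)%R -> (0 <= 1 + e * ln n)%R ->
  (1 + e * ln n)%:E * etrunc n r <= egker e r.
Proof.
move=> e0 n0 c0; rewrite /etrunc; case: ifPn => nr; last first.
  by rewrite mule0 lee_fin gker_ge0.
have r0 : (0 < r)%R by exact: lt_trans nr.
rewrite /egker -EFinM lee_fin /gker r0.
rewrite [leRHS](_ : _ = expR (e * ln r) * expR ((0 - 1) * ln r - r))%R; last first.
  by rewrite -expRD; congr expR; ring.
rewrite ler_wpM2r ?expR_ge0//; apply: le_trans (expR_ge1Dx _).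
by rewrite lerD2l ler_wpM2l ?(ltW e0)// ler_ln ?posrE// ltW.
Qed.

Lemma econv_etrunc_le (n x : R) : (0 < n < 1)%R ->
  econv heaviside eS x < +oo -> econv (tail (etrunc n)) eS x <= 1.
Proof.
move=> /andP[n0 n1] HS; have nS := nnm_eS; have nT := nnm_tail (nnm_etrunc n).
apply/lee_addgt0Pr => d d0.
pose L := (- ln n)%R.
have L0 : (0 < L)%R by rewrite oppr_gt0; apply: ln_lt0; rewrite n0.
have K0 : (0 < 1 + L * (1 + d))%R by rewrite ltr_wpDr// mulr_ge0//; lra.
(* The inequality to reach is [1 + e <= (1 - e * L) * (1 + d)], which rearranges to
   [e * (1 + L * (1 + d)) <= d]. *)
pose e : R := Num.min 1%R (d / (1 + L * (1 + d)))%R.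
have e0 : (0 < e)%R by rewrite lt_min ltr01 divr_gt0.
have e1 : (e <= 1)%R by rewrite ge_min lexx.
have ed : (e * (1 + L * (1 + d)) <= d)%R.
  by rewrite -ler_pdivlMr// ge_min lexx orbT.
have eL : (0 < 1 + e * ln n)%R.
  have -> : (1 + e * ln n = 1 - e * L)%R by rewrite mulrN opprK.
  have : (e * L * (1 + d) < 1 + d)%R by lra.
  rewrite -[X in (_ < X)%R]mul1r ltr_pM2r; lra.
have c0 : 0 <= (1 + e * ln n)%:E by rewrite lee_fin ltW.
have ng := nnm_tail (nnm_egker e).
have U : (1 + e * ln n)%:E * econv (tail (etrunc n)) eS x <= (1 + e)%:E.
  apply: (@le_trans _ _ (econv (tail (egker e)) eS x)).
    have := econvZl c0 nT nS; move/(congr1 (fun F => F x)) => <-.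
    apply: (le_econv x (nnm_scale c0 nT) nS ng nS) => // t.
    have [t0|t0] := leP t 0%R; first by rewrite !causal_tail// mule0.
    have [m1 p1] := nnm_etrunc n.
    have -> : (1 + e * ln n)%:E * tail (etrunc n) t
        = tail (fun r => (1 + e * ln n)%:E * etrunc n r) t.
      by rewrite !tailE// ge0_integralZl//; exact: measurable_funTS.
    apply: (le_tail (nnm_scale c0 (nnm_etrunc n)) (nnm_egker e)) => r _.
    by apply: etrunc_le => //; exact: ltW.
  rewrite econv_tail_egker//.
  apply: (@le_trans _ _ ((e^-1 + 1)%:E * e%:E)).
    apply: lee_pmul.
    - by rewrite lee_fin Gamma_ge0.
    - by apply: integral_ge0 => s _; exact: eP_ge0.
    - by rewrite -egamma_fineK// egamma_le// e0.
    - exact: integral_eP_le.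
  by rewrite -EFinM lee_fin mulrDl mulVf ?gt_eqF// mul1r.
rewrite -(@lee_pmul2l _ (1 + e * ln n)%:E)//.
apply: le_trans U _; rewrite -EFinD -EFinM lee_fin.
have -> : (1 + e * ln n = 1 - e * L)%R by rewrite mulrN opprK.
lra.
Qed.

(** The cut-off tends to 0 by monotone convergence. For fixed [y < x] the integrand is eventually
    constant, as the tail at [x - y] only sees [r > x - y]. *)
Lemma econv_E1_le (x : R) : econv heaviside eS x < +oo ->
  econv (tail (egker 0)) eS x <= 1.
Proof.
move=> HS; have nS := nnm_eS; have nH := @nnm_heaviside R.
have nT n := nnm_tail (nnm_etrunc n).
(* [n.+2] puts the cut-offs in []0, 1[], as [econv_etrunc_le] requires. *)
pose u (n : nat) : R := (n.+2%:R^-1)%R.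
have u0 n : (0 < u n)%R by rewrite invr_gt0.
have u1 n : (u n < 1)%R by rewrite invf_lt1// ltr1n.
have ud m n : (m <= n)%N -> (u n <= u m)%R.
  by move=> mn; rewrite lef_pV2 ?posrE// ler_nat.
pose g n y := tail (etrunc (u n)) (x - y)%R * eS y.
have cv : \int[mu]_y g n y @[n --> \oo] --> \int[mu]_y (tail (egker 0) (x - y)%R * eS y).
  rewrite [X in _ --> X](_ : _ = \int[mu]_y limn (g ^~ y)); last first.
    apply: eq_integral => y _; apply/esym/cvg_lim => //.
    apply: cvg_near_cst.
    have [xy|xy] := leP (x - y)%R 0%R.
      by apply: nearW => n; rewrite /g !causal_tail.
    have hV : (0 <= (x - y)^-1)%R by rewrite invr_ge0 ltW.
    exists (Num.bound (x - y)^-1) => // n /= hn.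
    rewrite /g !tailE//; congr (_ * _); apply: eq_integral => r.
    rewrite inE/= in_itv/= andbT => xr; rewrite /etrunc ifT//.
    apply: le_lt_trans xr; rewrite invf_ple ?posrE//.
    rewrite (le_trans (ltW (archi_boundP hV)))// ler_nat.
    exact: (leq_trans hn (leqW (leqnSn n))).
  apply: cvg_monotone_convergence => //.
  - by move=> n; case: (nnm_econv_integrand x (nT (u n)) nS).
  - by move=> n y _; exact: (nnm_econv_integrand x (nT (u n)) nS).2.
  - move=> y _ m n mn; apply: lee_wpmul2r; first exact: nS.2.
    apply: le_tail; [exact: nnm_etrunc|exact: nnm_etrunc|move=> r _].
    rewrite /etrunc; case: ifPn => h; last by case: ifP => // _; rewrite lee_fin gker_ge0.
    by rewrite ifT//; apply: le_lt_trans h; exact: ud.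
have -> : econv (tail (egker 0)) eS x = limn (fun n => \int[mu]_y g n y).
  by apply/esym/cvg_lim.
apply: lime_le; first by apply/cvg_ex; eexists; exact: cv.
by apply: nearW => n; apply: econv_etrunc_le => //; rewrite u0 u1.
Qed.

Theorem econv_E1_eS (x : R) : (0 < x)%R -> econv heaviside eS x < +oo ->
  econv (tail (egker 0)) eS x = 1.
Proof.
by move=> x0 HS; apply/eqP; rewrite eq_le econv_E1_le// econv_E1_ge.
Qed.

End volterra_kernel.

(** * Real-valued convolutions *)

Section real_convolution.
Context {R : realType}.
Local Notation mu := (@lebesgue_measure R).

Lemma expint1E (x : R) : 0 < x -> expint1 x = fine (tail (egker 0) x).
Proof.
move=> x0; rewrite tailE// /expint1 /Rintegral; congr fine.
have [mg g0] := nnm_egker (0 : R).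
rewrite integral_itv_obnd_cbnd; last exact: measurable_funTS.
apply: eq_integral => t; rewrite inE/= in_itv/= andbT => xt.
have t0 : 0 < t by exact: lt_le_trans xt.
by rewrite /egker gkerE// sub0r powR_inv1 ?(ltW t0)// mulrC.
Qed.

Lemma kernelSE (t : R) : 0 < t -> kernelS t = fine (eS t).
Proof.
move=> t0; rewrite /kernelS /Rintegral /eS.
have -> : (\int[mu]_s epker s t)%E =
  ((expR (- t))%:E * \int[mu]_(s in `]0%R, +oo[) (t `^ (s - 1) / Gamma s)%:E)%E.
  rewrite -ge0_integralZl//.
  - rewrite [RHS]integral_mkcond; apply: eq_integral => s _.
    rewrite patchE mem_setE in_itv/= andbT /epker /pker.
    case: ifPn => // s0; rewrite gkerE// -EFinM; congr (_%:E); ring.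
  - apply/measurable_EFinP; apply: measurable_funTS; apply: measurable_funM.
      by apply: (measurableT_comp (measurable_powRr _)); exact: measurable_funB.
    have -> : (fun z : R => (Gamma z)^-1) = (fun z => Gamma z `^ (- 1)).
      by apply/funext => z; rewrite powR_inv1// Gamma_ge0.
    by apply: (measurableT_comp (measurable_powR _)); exact: measurable_Gamma.
  - by move=> s _; rewrite lee_fin divr_ge0 ?powR_ge0 ?Gamma_ge0.
(* Were the integral infinite, both sides would be 0, the value of [fine] at infinity. *)
case: (\int[mu]_(s in `]0%R, +oo[) _)%E => [r| |]//=.
- by rewrite gt0_muley ?lte_fin ?expR_gt0//= mulr0.
- by rewrite gt0_muleNy ?lte_fin ?expR_gt0//= mulr0.
Qed.

Lemma eP_fin_num (s x : R) : 0 < s -> eP s x \is a fin_num.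
Proof.
by move=> s0; rewrite ge0_fin_numE ?eP_ge0// (le_lt_trans (eP_le1 x s0))// ltry.
Qed.

Lemma lower_gammaPE (s x : R) : 0 < s -> (lower_gammaP s x)%:E = eP s x.
Proof.
move=> s0; rewrite -[RHS]fineK ?eP_fin_num//; congr (_%:E).
have G0 : (0 <= (Gamma s)^-1%:E)%E by rewrite lee_fin invr_ge0 Gamma_ge0.
rewrite /eP epkerE// (econvZr G0 (@nnm_heaviside R) (nnm_egker s)).
rewrite (causal_econv_heaviside _ (@causal_egker _ s)).
rewrite /lower_gammaP /Rintegral.
have -> : (\int[mu]_(y in `]0%R, x[) egker s y)%E =
          (\int[mu]_(t in `]0%R, x[) (t `^ (s - 1) * expR (- t))%:E)%E.
  apply: eq_integral => t; rewrite inE/= in_itv/= => /andP[t0 _].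
  by rewrite /egker gkerE.
have : (0 <= \int[mu]_(t in `]0%R, x[) (t `^ (s - 1) * expR (- t))%:E)%E.
  by apply: integral_ge0 => t _; rewrite lee_fin mulr_ge0 ?powR_ge0 ?expR_ge0.
case: (\int[mu]_(t in `]0%R, x[) _)%E => [r| |]//= _.
by rewrite gt0_muley ?lte_fin ?invr_gt0 ?Gamma_gt0//= mulr0.
Qed.

Lemma integral_lower_gammaP (x : R) :
  (\int[mu]_(s in `]0%R, +oo[) (lower_gammaP s x)%:E = econv heaviside eS x)%E.
Proof.
rewrite econv_eS; last exact: nnm_heaviside.
rewrite integral_mkcond; apply: eq_integral => s _.
rewrite patchE mem_setE in_itv/= andbT; case: ifPn => s0; first exact: lower_gammaPE.
by symmetry; apply: integral0_eq => y _; rewrite /epker /pker (negbTE s0) mule0.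
Qed.

(** By Tonelli each [r] is counted for [t] in []0, r[], and the weight [r] cancels the singularity
    [1/r]. This is the integrability of [E1], which makes the fractional integral of a bounded
    function finite. *)
Lemma integral_tail_egker0 : (\int[mu]_t tail (egker 0) t = 1)%E.
Proof.
have nk := nnm_egker (0 : R); have [mk k0] := nk.
transitivity (\int[mu]_t \int[mu]_r (heaviside t * (heaviside (r - t)%R * egker 0 r)))%E.
  apply: eq_integral => t _; rewrite /tail ge0_integralZl//.
  - exact: (nnm_tail_integrand t nk).1.
  - by move=> r _; exact: (nnm_tail_integrand t nk).2.
  - exact: heaviside_ge0.
rewrite (@tonelli R (fun z => heaviside z.1 * (heaviside (z.2 - z.1)%R * egker 0 z.2))%E)/=; last 2 first.
- apply: emeasurable_funM; last exact: measurable_tail_integrand.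
  by apply: (measurableT_comp (@nnm_heaviside R).1).
- by move=> z; rewrite !mule_ge0 ?heaviside_ge0.
transitivity (\int[mu]_(r in `]0%R, +oo[) (expR (- (1 * r)))%:E)%E; last first.
  rewrite integral_itv_obnd_cbnd ?integral_expRN ?invr1//.
  by apply/measurable_EFinP/measurable_funTS; exact: measurable_expRN.
rewrite [RHS]integral_mkcond; apply: eq_integral => r _.
rewrite patchE mem_setE in_itv/= andbT.
transitivity (egker 0 r * \int[mu]_(t in `]-oo, r[) heaviside t)%E.
  rewrite -econv_heaviside /econv -ge0_integralZl//.
  - by apply: eq_integral => t _; rewrite muleA muleC [X in (_ * X)%E]muleC.
  - exact: (nnm_econv_integrand r (@nnm_heaviside R) (@nnm_heaviside R)).1.
  - by move=> t _; exact: (nnm_econv_integrand r (@nnm_heaviside R) (@nnm_heaviside R)).2.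
have [r0|r0] := leP r 0; first by rewrite (causal_egker _ r0) mul0e.
rewrite -econv_heaviside (causal_econv_heaviside _ (@causal_heaviside R)).
rewrite (eq_integral (fun=> 1%E)); last first.
  by move=> t; rewrite inE/= in_itv/= /heaviside => /andP[-> _].
rewrite integral_cst//= lebesgue_measure_itv/= lte_fin r0 mul1e oppr0 adde0.
rewrite /egker -EFinM gkerE// sub0r powR_inv1 ?(ltW r0)// mul1r.
by congr (_%:E); field; rewrite gt_eqF.
Qed.

Lemma econv_heaviside_le_integral (a : R -> \bar R) (x : R) : nnm a ->
  (econv heaviside a x <= \int[mu]_y a y)%E.
Proof.
by move=> [ma a0]; rewrite econv_heaviside; apply: ge0_subset_integral.
Qed.

Definition bounded_measurable (v : R -> R) :=
  measurable_fun setT v /\ exists M, forall x, `|v x| <= M.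

(** The positive part on []0, +oo[]; the negative part is [ppos] of the opposite function. A signed
    convolution is the difference of the two resulting nonnegative ones. *)
Definition ppos (v : R -> R) (t : R) : \bar R := (heaviside t * (Num.max (v t) 0)%:E)%E.

Lemma nnm_ppos v : measurable_fun setT v -> nnm (ppos v).
Proof.
move=> mv; apply: nnm_mul; first exact: nnm_heaviside.
apply: (nnm_EFin (f := fun t => Num.max (v t) 0)).
  exact: measurable_maxr.
by move=> x; rewrite le_max lexx orbT.
Qed.

Lemma causal_ppos v : causal (ppos v).
Proof. by move=> t t0; rewrite /ppos causal_heaviside// mul0e. Qed.

Lemma bounded_measurableN v : bounded_measurable v -> bounded_measurable (fun x => - v x).
Proof.
move=> [mv [M vM]]; split; first exact: measurableT_comp.
by exists M => x; rewrite normrN.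
Qed.

Lemma ppos_le v M t : (forall x, `|v x| <= M) -> (ppos v t <= M%:E * heaviside t)%E.
Proof.
move=> vM; rewrite /ppos muleC lee_wpmul2r ?heaviside_ge0// lee_fin ge_max.
have := vM t; rewrite (le_trans (normr_ge0 _) (vM t)) andbT; apply: le_trans.
exact: ler_norm.
Qed.

Lemma econv_ppos_lty (a : R -> \bar R) v x : nnm a -> bounded_measurable v ->
  (econv heaviside a x < +oo)%E -> (econv a (ppos v) x < +oo)%E.
Proof.
move=> na [mv [M vM]] ax; have M0 : (0 <= M%:E)%E.
  by rewrite lee_fin (le_trans _ (vM 0)).
have nH := @nnm_heaviside R.
apply: (@le_lt_trans _ _ (M%:E * econv a heaviside x)%E).
  have := econvZr M0 na nH => /(congr1 (fun F => F x)) <-.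
  apply: (le_econv x na (nnm_ppos mv) na (nnm_scale M0 nH)) => // y.
  exact: ppos_le.
by rewrite (econvC na nH) lte_mul_pinfty.
Qed.

Lemma econv_ppos_fin_num (a : R -> \bar R) v x : nnm a -> bounded_measurable v ->
  (econv heaviside a x < +oo)%E -> econv a (ppos v) x \is a fin_num.
Proof.
move=> na bv ax; rewrite ge0_fin_numE; first exact: econv_ppos_lty.
exact: (nnm_econv na (nnm_ppos bv.1)).2.
Qed.

(* The real-valued kernels of the statement are [fine] of extended-real ones. *)
Definition kernel_of (kap : R -> R) (a : R -> \bar R) :=
  [/\ nnm a, causal a & forall t, 0 < t -> kap t = fine (a t)].

(** Where [a] is infinite, [fine] returns 0 and the real kernel departs from the extended one.
    Finiteness of [H * a] at [x] confines such points to a null set. *)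
Lemma ae_fin_num_kernel (a : R -> \bar R) x : nnm a ->
  (econv heaviside a x < +oo)%E ->
  {ae mu, forall y, 0 < y -> a (x - y) \is a fin_num}.
Proof.
move=> na ax; have nH := @nnm_heaviside R.
have ig : mu.-integrable setT (fun y => a (x - y)%R * heaviside y)%E.
  have [m p] := nnm_econv_integrand x na nH.
  apply/integrableP; split => //.
  under eq_integral do rewrite gee0_abs//.
  by rewrite -/(econv a heaviside x) (econvC na nH).
have := integrable_ae measurableT ig.
apply: filterS.
move=> y /(_ I); rewrite /heaviside => h y0; move: h.
by rewrite y0 mule1.
Qed.

Lemma integral_pos_part (kap : R -> R) (a : R -> \bar R) (v : R -> R) x :
  kernel_of kap a -> bounded_measurable v -> (econv heaviside a x < +oo)%E ->
  (\int[mu]_(y in `]0%R, x[) (EFin \o (fun y => (kap (x - y) * v y)%R))^\+ y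
   = econv a (ppos v) x)%E.
Proof.
move=> [na ca ka] [mv bv] ax.
have [ma a0] := nnm_econv_integrand x na (nnm_ppos mv).
rewrite integral_mkcond.
have mm : measurable_fun setT (((EFin \o (fun y => (kap (x - y) * v y)%R))^\+)%E \_ `]0%R, x[%classic).
  apply/(measurable_restrictT _ _).1 => //.
  apply: measurable_funepos; apply/measurable_EFinP; apply: measurable_funM; last exact: measurable_funTS.
  have h : measurable_fun `]0%R, x[ (fun y : R => fine (a (x - y))).
    apply: measurable_funTS; apply: measurableT_comp => //.
    by apply: (measurableT_comp na.1); exact: measurable_funB.
  apply: eq_measurable_fun h => y; rewrite inE/= in_itv/= => /andP[_ yx].
  by rewrite ka// subr_gt0.
apply: ge0_ae_eq_integral => //.
  by move=> y _; rewrite patchE; case: ifP => // _; rewrite funepos_ge0.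
move: (ae_fin_num_kernel na ax); apply: filterS; first exact: (ae_filter_ringOfSetsType mu).
move=> y af _; rewrite patchE mem_setE in_itv/=.
have [y0|y0]/= := leP y 0; first by rewrite causal_ppos// mule0.
have [xy|xy] := leP x y; first by rewrite ca ?mul0e// subr_le0.
rewrite funeposE/= ka ?subr_gt0// /ppos /heaviside y0 mul1e.
rewrite -{2}(fineK (af y0)) -EFinM -EFin_max; congr (_%:E).
have f0 : 0 <= fine (a (x - y)) by rewrite fine_ge0// na.2.
by rewrite maxr_pMr// mulr0.
Qed.

Definition rconv (kap v : R -> R) (x : R) : R :=
  \int[mu]_(y in `]0%R, x[) (kap (x - y) * v y).

Lemma rconvE (kap : R -> R) (a : R -> \bar R) (v : R -> R) x :
  kernel_of kap a -> bounded_measurable v -> (econv heaviside a x < +oo)%E ->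
  rconv kap v x = fine (econv a (ppos v) x) - fine (econv a (ppos (fun y => - v y)) x).
Proof.
move=> ka bv ax; have [na ca _] := ka.
rewrite /rconv /Rintegral integralE.
have -> : (\int[mu]_(y in `]0%R, x[) (EFin \o (fun y => (kap (x - y) * v y)%R))^\- y)%E
  = econv a (ppos (fun y => - v y)) x.
  rewrite -(integral_pos_part ka (bounded_measurableN bv) ax).
  apply: eq_integral => y _; rewrite funenegE funeposE/=; congr maxe.
  by rewrite mulrN.
rewrite (integral_pos_part ka bv ax) fineB//; apply: econv_ppos_fin_num => //.
exact: bounded_measurableN.
Qed.

End real_convolution.

(** * Bounds, linearity and associativity of signed convolutions *)

Section real_convolution_theory.
Context {R : realType}.
Local Notation mu := (@lebesgue_measure R).

Lemma bounded_measurable_norm (v : R -> R) : bounded_measurable v ->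
  bounded_measurable (fun x => `|v x|).
Proof.
move=> [mv [M vM]]; split; first exact: measurableT_comp.
by exists M => x; rewrite normr_id.
Qed.

Lemma measurable_rconv_integrand (kap : R -> R) (a : R -> \bar R) (v : R -> R) (x : R) :
  kernel_of kap a -> measurable_fun setT v ->
  measurable_fun `]0%R, x[ (fun y => kap (x - y) * v y).
Proof.
move=> [na ca ka] mv.
apply: measurable_funM; last exact: measurable_funTS.
have h : measurable_fun `]0%R, x[ (fun y : R => fine (a (x - y))).
  apply: measurable_funTS; apply: measurableT_comp => //.
  by apply: (measurableT_comp na.1); exact: measurable_funB.
apply: eq_measurable_fun h => y; rewrite inE/= in_itv/= => /andP[_ yx].
by rewrite ka// subr_gt0.
Qed.

Lemma kernel_of_ge0 (kap : R -> R) (a : R -> \bar R) (t : R) : kernel_of kap a ->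
  0 < t -> 0 <= kap t.
Proof. by move=> [na ca ka] t0; rewrite ka// fine_ge0// na.2. Qed.

Lemma integral_abs_rconv (kap : R -> R) (a : R -> \bar R) (v : R -> R) (x : R) :
  kernel_of kap a -> bounded_measurable v -> (econv heaviside a x < +oo)%E ->
  (\int[mu]_(y in `]0%R, x[) `|(kap (x - y) * v y)%R|%:E
   = econv a (ppos (fun y => `|v y|%R)) x)%E.
Proof.
move=> ka bv ax.
rewrite -(integral_pos_part ka (bounded_measurable_norm bv) ax).
apply: eq_integral => y; rewrite inE/= in_itv/= => /andP[_ yx].
have k0 : 0 <= kap (x - y) by apply: (kernel_of_ge0 ka); rewrite subr_gt0.
rewrite funeposE/= -EFin_max; congr (_%:E).
by rewrite normrM (ger0_norm k0) max_l// mulr_ge0.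
Qed.

Lemma integrable_rconv (kap : R -> R) (a : R -> \bar R) (v : R -> R) (x : R) :
  kernel_of kap a -> bounded_measurable v -> (econv heaviside a x < +oo)%E ->
  mu.-integrable `]0%R, x[ (EFin \o (fun y => kap (x - y) * v y)).
Proof.
move=> ka bv ax; apply/integrableP; split.
  by apply/measurable_EFinP; exact: (measurable_rconv_integrand ka bv.1).
have := integral_abs_rconv ka bv ax; rewrite /= => ->.
by apply: (econv_ppos_lty _ (bounded_measurable_norm bv) ax); case: ka.
Qed.

(** Combines a sup bound on the function with an integral bound on the kernel, which may be
    unbounded at 0. For the kernel [S] this is the source of the contraction ratio. *)
Lemma rconv_bound (kap : R -> R) (a : R -> \bar R) (v : R -> R) (x M : R) :
  kernel_of kap a -> bounded_measurable v -> (econv heaviside a x < +oo)%E ->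
  0 <= M -> (forall y, 0 < y < x -> `|v y| <= M) ->
  `|rconv kap v x| <= M * fine (econv heaviside a x).
Proof.
move=> ka bv ax M0 vM; have [na ca _] := ka.
have nH := @nnm_heaviside R.
have Ha0 : (0 <= econv heaviside a x)%E by exact: (nnm_econv nH na).2.
rewrite -lee_fin /rconv.
apply: (@le_trans _ _ (econv a (ppos (fun y => `|v y|%R)) x)).
  rewrite -(integral_abs_rconv ka bv ax).
  apply: (@le_trans _ _ (`|\int[mu]_(y in `]0%R, x[) (kap (x - y) * v y)%:E|)%E).
    by rewrite EFin_normr_Rintegral//; exact: (integrable_rconv ka bv ax).
  apply: le_abse_integral => //; apply/measurable_EFinP.
  exact: (measurable_rconv_integrand ka bv.1).
have MH := nnm_scale (c := M%:E) M0 nH.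
rewrite EFinM fineK ?ge0_fin_numE// (econvC nH na).
have := econvZr (c := M%:E) M0 na nH => /(congr1 (fun F => F x)) <-.
apply: ge0_le_integral => //.
- by move=> y _; exact: (nnm_econv_integrand x na (nnm_ppos (bounded_measurable_norm bv).1)).2.
- exact: (nnm_econv_integrand x na (nnm_ppos (bounded_measurable_norm bv).1)).1.
- exact: (nnm_econv_integrand x na MH).1.
move=> y _; have [xy|xy] := leP x y; first by rewrite ca ?mul0e// subr_le0.
apply: lee_wpmul2l; first exact: na.2.
rewrite /ppos /heaviside; case: ifPn => y0; last by rewrite mul0e mule0.
by rewrite mul1e mule1 lee_fin max_l// vM// y0.
Qed.

Lemma rconvB (kap : R -> R) (a : R -> \bar R) (v w : R -> R) (x : R) :
  kernel_of kap a -> bounded_measurable v -> bounded_measurable w ->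
  (econv heaviside a x < +oo)%E ->
  rconv kap v x - rconv kap w x = rconv kap (fun y => v y - w y) x.
Proof.
move=> ka bv bw ax; rewrite /rconv -RintegralB//.
- by apply: eq_Rintegral => y _; rewrite mulrBr.
- exact: (integrable_rconv ka bv ax).
- exact: (integrable_rconv ka bw ax).
Qed.

Lemma rconvZ (kap : R -> R) (a : R -> \bar R) (v : R -> R) c (x : R) :
  kernel_of kap a -> bounded_measurable v -> (econv heaviside a x < +oo)%E ->
  rconv kap (fun y => c * v y) x = c * rconv kap v x.
Proof.
move=> ka bv ax; rewrite /rconv -RintegralZl//.
- by apply: eq_Rintegral => y _; rewrite mulrCA.
- exact: (integrable_rconv ka bv ax).
Qed.

Lemma eq_rconv (kap v w : R -> R) (x : R) : (forall y, 0 < y < x -> v y = w y) ->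
  rconv kap v x = rconv kap w x.
Proof.
by move=> vw; apply: eq_Rintegral => y; rewrite inE/= in_itv/= => h; rewrite vw.
Qed.

Lemma ae_eq_rconv (kap : R -> R) (a : R -> \bar R) (v w : R -> R) (x : R) :
  kernel_of kap a -> bounded_measurable v -> bounded_measurable w ->
  {ae mu, forall y, 0 < y < x -> v y = w y} ->
  rconv kap v x = rconv kap w x.
Proof.
move=> ka bv bw vw; rewrite /rconv /Rintegral; congr fine.
apply: ae_eq_integral => //.
- by apply/measurable_EFinP; exact: (measurable_rconv_integrand ka bv.1).
- by apply/measurable_EFinP; exact: (measurable_rconv_integrand ka bw.1).
move: vw; apply: filterS; first exact: (ae_filter_ringOfSetsType mu).
by move=> y h; rewrite /= in_itv/= => /h ->.
Qed.

(** Extension by zero turns a function continuous only within [[0, 1]] into one that is bounded and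
    measurable on the line. *)
Definition restr01 (v : R -> R) : R -> R := v \_ `[0%R, 1%R].

Lemma restr01E v (y : R) : 0 <= y <= 1 -> restr01 v y = v y.
Proof. by move=> y01; rewrite /restr01 patchE mem_set//= in_itv. Qed.

Lemma rconv_restr01 (kap v : R -> R) (x : R) : x <= 1 ->
  rconv kap (restr01 v) x = rconv kap v x.
Proof.
move=> x1; apply: eq_rconv => y /andP[y0 yx]; rewrite restr01E// (ltW y0)/=; lra.
Qed.

Lemma econv_heaviside_lty (a : R -> \bar R) (x : R) : nnm a -> x <= 1 ->
  (econv heaviside a 1%R < +oo)%E -> (econv heaviside a x < +oo)%E.
Proof. by move=> na x1; apply: le_lt_trans; exact: nd_econv_heaviside. Qed.

Lemma bounded_measurable_rconv (kap : R -> R) (a : R -> \bar R) (v : R -> R) :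
  kernel_of kap a -> bounded_measurable v -> (econv heaviside a 1%R < +oo)%E ->
  bounded_measurable (restr01 (rconv kap v)).
Proof.
move=> ka bv a1; have [na ca _] := ka; have [mv [M vM]] := bv.
have M0 : 0 <= M by exact: le_trans (vM 0).
split.
  apply/(measurable_restrictT _ _).1 => //.
  have h : measurable_fun (`[0%R, 1%R]%classic : set R) (fun x => fine (econv a (ppos v) x)
      - fine (econv a (ppos (fun y => - v y)) x)).
    apply: measurable_funTS; apply: measurable_funB; apply: measurableT_comp => //.
      exact: (nnm_econv na (nnm_ppos mv)).1.
    exact: (nnm_econv na (nnm_ppos (bounded_measurableN bv).1)).1.
  apply: eq_measurable_fun h => x; rewrite inE/= in_itv/= => /andP[_ x1].
  by rewrite (rconvE ka bv)//; exact: econv_heaviside_lty.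
have H0 y : (0 <= econv heaviside a y)%E by exact: (nnm_econv nnm_heaviside na).2.
exists (M * fine (econv heaviside a 1%R)) => x.
rewrite /restr01 patchE mem_setE in_itv/=; case: ifPn => [/andP[x0 x1]|_]; last first.
  by rewrite normr0 mulr_ge0// fine_ge0.
have ax := econv_heaviside_lty na x1 a1.
apply: le_trans (rconv_bound ka bv ax M0 (fun y _ => vM y)) _.
rewrite ler_wpM2l// fine_le ?ge0_fin_numE//.
exact: nd_econv_heaviside.
Qed.

Lemma fine_subr_eq (A B C D : \bar R) : A \is a fin_num -> B \is a fin_num ->
  C \is a fin_num -> D \is a fin_num -> (A + B = C + D)%E ->
  fine A - fine C = fine D - fine B.
Proof. by case: A B C D => [a||] [b||] [c||] [d||]//= _ _ _ _ []; lra. Qed.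

(** The positive part of [ka' * w] is not the convolution of [ka'] with the positive part of [w], so
    [econvA] does not apply part by part. The relation between the parts is rewritten as an equality
    of sums of nonnegative functions, convolved with [a], and only then subtracted. *)
Lemma rconv_assoc (kap ka' : R -> R) (a b : R -> \bar R) (w : R -> R) (x : R) :
  kernel_of kap a -> kernel_of ka' b -> bounded_measurable w ->
  (econv heaviside a 1%R < +oo)%E -> (econv heaviside b 1%R < +oo)%E ->
  x <= 1 ->
  rconv kap (rconv ka' w) x =
  fine (econv (econv a b) (ppos w) x)
  - fine (econv (econv a b) (ppos (fun y => - w y)%R) x).
Proof.
move=> ka kb bw a1 b1 x1; have [na ca _] := ka; have [nb cb _] := kb.
have bNw := bounded_measurableN bw.
have ax := econv_heaviside_lty na x1 a1.
have nH := @nnm_heaviside R.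
(* The inner convolution is cut to [[0, 1]], where it is known to be bounded; since [x <= 1], the
   outer one sees nothing else. *)
have [u uE bu] : exists2 u, (forall y, 0 <= y <= 1 -> u y = rconv ka' w y) & bounded_measurable u.
  exists (restr01 (rconv ka' w)); last exact: (bounded_measurable_rconv kb bw b1).
  by move=> y y01; rewrite restr01E.
have bNu := bounded_measurableN bu.
have -> : rconv kap (rconv ka' w) x = rconv kap u x.
  by apply: eq_rconv => y /andP[y0 yx]; rewrite uE// (ltW y0)/=; lra.
rewrite (rconvE ka bu ax).
have [nw nNw] := (nnm_ppos bw.1, nnm_ppos bNw.1).
have [nu nNu] := (nnm_ppos bu.1, nnm_ppos bNu.1).
rewrite (econvA na nb nw) (econvA na nb nNw).
have nbw := nnm_econv nb nw; have nbNw := nnm_econv nb nNw.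
(* Up to time 1, [b * ppos v] is at most the constant [M * B], and [a] convolved with a constant is
   finite at [x]. *)
have fin v : bounded_measurable v -> econv a (econv b (ppos v)) x \is a fin_num.
  move=> bv; have nv := nnm_ppos bv.1.
  rewrite ge0_fin_numE; last exact: (nnm_econv na (nnm_econv nb nv)).2.
  have [mv [M vM]] := bv; have M0 : 0 <= M by exact: le_trans (vM 0).
  have [B bE B0] : exists2 B : R, econv heaviside b 1%R = B%:E & 0 <= B.
    have h := (nnm_econv nH nb).2 1.
    exists (fine (econv heaviside b 1%R)); last exact: fine_ge0.
    by apply/esym/fineK; rewrite ge0_fin_numE.
  have [K0 MM0] : (0 <= (M * B)%:E)%E /\ (0 <= M%:E)%E.
    by rewrite !lee_fin mulr_ge0.
  apply: (@le_lt_trans _ _ ((M * B)%:E * econv heaviside a x)%E); last first.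
    by apply: lte_mul_pinfty => //.
  rewrite (econvC nH na) -[X in (_ <= X)%E](congr1 (fun F => F x) (econvZr K0 na nH)).
  have nMH := nnm_scale K0 nH.
  apply: ge0_le_integral => [//|y _||| y _].
  - exact: (nnm_econv_integrand x na (nnm_econv nb nv)).2.
  - exact: (nnm_econv_integrand x na (nnm_econv nb nv)).1.
  - exact: (nnm_econv_integrand x na nMH).1.
  have [xy|xy] := leP x y; first by rewrite ca ?mul0e// subr_le0.
  apply: lee_wpmul2l; first exact: na.2.
  have [y0|y0] := leP y 0.
    by rewrite (causal_econv cb (@causal_ppos _ v) y0); exact: nMH.2.
  rewrite /heaviside y0 mule1.
  apply: (@le_trans _ _ (econv b (fun t => M%:E * heaviside t)%E y)).
    apply: (le_econv y nb nv nb (nnm_scale MM0 nH)) => [t|t]; first by [].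
    exact: ppos_le.
  rewrite (congr1 (fun F => F y) (econvZr MM0 nb nH)) EFinM -bE.
  apply: lee_wpmul2l; first by [].
  by rewrite (econvC nb nH); apply: nd_econv_heaviside; [exact: nb|lra].
(* With [u = A - B], where [A] and [B] are [b] convolved with the two parts of [w], this is
   [max(u, 0) + B = max(-u, 0) + A] convolved with [a]. *)
have key : (econv a (ppos u) x + econv a (econv b (ppos (fun y => - w y)%R)) x
          = econv a (ppos (fun y => - u y)%R) x + econv a (econv b (ppos w)) x)%E.
  transitivity (econv a (fun t => ppos u t + econv b (ppos (fun y => - w y)%R) t) x)%E.
    by rewrite (econvDr na nu nbNw).
  transitivity (econv a (fun t => ppos (fun y => - u y)%R t + econv b (ppos w) t) x)%E; last first.
    by rewrite (econvDr na nNu nbw).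
  apply: (eq_econv ca _ ca) => [y y0|y y0|y _|y /andP[y0 yx]].
  - by rewrite (causal_ppos _ y0) (causal_econv cb (@causal_ppos _ (fun y => - w y)%R) y0) adde0.
  - by rewrite (causal_ppos _ y0) (causal_econv cb (@causal_ppos _ w) y0) adde0.
  - by [].
  have y1 : y <= 1 by lra.
  have bx := econv_heaviside_lty nb y1 b1.
  have := rconvE kb bw bx; rewrite -uE; last by rewrite (ltW y0).
  move: (econv_ppos_fin_num nb bw bx) (econv_ppos_fin_num nb bNw bx).
  case: (econv b (ppos w) y) => // A _; case: (econv b _ y) => // B _ /= uy.
  rewrite /ppos /heaviside y0 !mul1e -!EFinD; congr (_%:E).
  rewrite uy; case: (leP (A - B) 0) => h1; case: (leP (- (A - B)) 0) => h2; lra.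
have f1 := econv_ppos_fin_num na bu ax; have f2 := econv_ppos_fin_num na bNu ax.
have f3 := fin _ bw; have f4 := fin _ bNw.
exact: (fine_subr_eq f1 f4 f2 f3 key).
Qed.

End real_convolution_theory.

(** * The kernels rescaled by alpha, inversion of the fractional integral *)

Section fractional_kernels.
Context {R : realType}.
Local Notation mu := (@lebesgue_measure R).
Variable alpha : R.
Hypothesis alpha0 : 0 < alpha.

Let ai0 : 0 < alpha^-1. Proof. by rewrite invr_gt0. Qed.

Definition ekerE1 (t : R) : \bar R := tail (egker 0) (alpha^-1 * t).
Definition ekerS (t : R) : \bar R := eS (alpha^-1 * t).

Lemma kernel_of_E1 : kernel_of (fun t => expint1 (t / alpha)) ekerE1.
Proof.
have nT := nnm_tail (nnm_egker (0 : R)).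
split; first exact: nnm_dilate.
- by apply: (causal_dilate ai0); exact: causal_tail.
- by move=> t t0; rewrite (expint1E (divr_gt0 t0 alpha0)) [t / alpha]mulrC.
Qed.

Lemma kernel_of_S : kernel_of (fun t => kernelS (t / alpha)) ekerS.
Proof.
split; first by apply: nnm_dilate; exact: nnm_eS.
- by apply: (causal_dilate ai0); exact: causal_eS.
- by move=> t t0; rewrite (kernelSE (divr_gt0 t0 alpha0)) [t / alpha]mulrC.
Qed.

(** Integration from 0 is convolution with the constant 1, so that [rconv_assoc] also exchanges
    integration with convolution by [S]. *)
Lemma kernel_of_1 : kernel_of (fun=> 1) (@heaviside R).
Proof.
split; [exact: nnm_heaviside|exact: causal_heaviside|].
by move=> t t0; rewrite /heaviside t0.
Qed.

Lemma econv_heaviside_dilate (a : R -> \bar R) x : nnm a ->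
  econv heaviside (fun t => a (alpha^-1 * t)) x
  = (alpha%:E * econv heaviside a (alpha^-1 * x)%R)%E.
Proof.
move=> na; rewrite -[X in (X%:E * _)%E]invrK.
rewrite -(econv_dilate x ai0 (@nnm_heaviside R) na).
congr (econv _ _ x); apply/funext => t; rewrite /heaviside pmulr_rgt0//.
Qed.

Lemma econv_heaviside_E1_lty x : (econv heaviside ekerE1 x < +oo)%E.
Proof.
have nT := nnm_tail (nnm_egker (0 : R)).
rewrite /ekerE1 (econv_heaviside_dilate x nT) lte_mul_pinfty ?lee_fin ?(ltW alpha0)//.
apply: le_lt_trans (econv_heaviside_le_integral _ nT) _.
by rewrite integral_tail_egker0 ltry.
Qed.

Lemma econv_heaviside_heaviside_lty (x : R) : (econv heaviside (@heaviside R) x < +oo)%E.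
Proof.
rewrite (causal_econv_heaviside _ (@causal_heaviside R)).
apply: (@le_lt_trans _ _ (\int[mu]_(y in `]0%R, x[) 1)%E).
  apply: ge0_le_integral => //.
  - by move=> y _; exact: heaviside_ge0.
  - by apply: measurable_funTS; exact: (@nnm_heaviside R).1.
  - by move=> y _; rewrite /heaviside; case: ifP.
rewrite integral_cst//= lebesgue_measure_itv/=; case: ifP => _; rewrite mul1e//.
by rewrite -EFinD ltry.
Qed.

Hypothesis HS : (econv heaviside (@eS R) alpha^-1 < +oo)%E.

Lemma econv_heaviside_S : econv heaviside ekerS 1 = (alpha%:E * econv heaviside (@eS R) alpha^-1)%E.
Proof. rewrite (econv_heaviside_dilate 1 (@nnm_eS R)); congr (_ * econv _ _ _)%E.
exact: mulr1. Qed.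

Lemma econv_heaviside_S_lty : (econv heaviside ekerS 1 < +oo)%E.
Proof. by rewrite econv_heaviside_S lte_mul_pinfty ?lee_fin ?(ltW alpha0). Qed.

(** Dilating both kernels multiplies their convolution by [alpha], which the factor [alpha^-1] of
    the fractional integral compensates. The bound [x <= 1] keeps [x / alpha] in the range where
    [H * S] is known to be finite. *)
Lemma econv_E1_S (x : R) : 0 < x <= 1 -> econv ekerE1 ekerS x = alpha%:E.
Proof.
move=> /andP[x0 x1]; have nT := nnm_tail (nnm_egker (0 : R)).
rewrite /ekerE1 /ekerS (econv_dilate x ai0 nT (@nnm_eS R)) invrK econv_E1_eS ?mule1 ?mulr_gt0//.
apply: le_lt_trans HS; apply: nd_econv_heaviside; first exact: nnm_eS.
by rewrite -[leRHS]mulr1 ler_pM2l.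
Qed.

Lemma econv_E1_S_ppos (w : R -> R) x : measurable_fun setT w -> x <= 1 ->
  econv (econv ekerE1 ekerS) (ppos w) x = (alpha%:E * econv heaviside (ppos w) x)%E.
Proof.
move=> mw x1; have nH := @nnm_heaviside R.
have [[n1 c1 _] [n2 c2 _]] := (kernel_of_E1, kernel_of_S).
have a0 : (0 <= alpha%:E)%E by rewrite lee_fin ltW.
rewrite -(congr1 (fun F => F x) (econvZl a0 nH (nnm_ppos mw))).
apply: eq_econv => [||y y0||y /andP[y0 yx]|//].
- exact: causal_econv.
- exact: causal_ppos.
- by rewrite (causal_heaviside y0) mule0.
- exact: causal_ppos.
- by rewrite econv_E1_S /heaviside ?y0 ?mule1//=; lra.
Qed.

Lemma fineZ (c : R) (z : \bar R) : z \is a fin_num -> fine (c%:E * z) = c * fine z.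
Proof. by case: z. Qed.

Lemma rconv_E1_S (w : R -> R) (x : R) : bounded_measurable w -> x <= 1 ->
  rconv (fun t => expint1 (t / alpha)) (rconv (fun t => kernelS (t / alpha)) w) x
  = alpha * rconv (fun=> 1) w x.
Proof.
move=> bw x1; have bNw := bounded_measurableN bw.
have HH := econv_heaviside_heaviside_lty x; have nH := @nnm_heaviside R.
rewrite (rconv_assoc kernel_of_E1 kernel_of_S bw (econv_heaviside_E1_lty 1)
  econv_heaviside_S_lty x1).
rewrite (econv_E1_S_ppos bw.1 x1) (econv_E1_S_ppos bNw.1 x1).
rewrite (rconvE kernel_of_1 bw HH) mulrBr.
rewrite (fineZ _ (econv_ppos_fin_num nH bw HH)).
by rewrite (fineZ _ (econv_ppos_fin_num nH bNw HH)).
Qed.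

Lemma rconv_S_E1 (w : R -> R) (x : R) : bounded_measurable w -> x <= 1 ->
  rconv (fun t => kernelS (t / alpha)) (rconv (fun t => expint1 (t / alpha)) w) x
  = alpha * rconv (fun=> 1) w x.
Proof.
move=> bw x1; have bNw := bounded_measurableN bw.
have HH := econv_heaviside_heaviside_lty x; have nH := @nnm_heaviside R.
have [[n1 c1 _] [n2 c2 _]] := (kernel_of_E1, kernel_of_S).
rewrite (rconv_assoc kernel_of_S kernel_of_E1 bw econv_heaviside_S_lty
  (econv_heaviside_E1_lty 1) x1) (econvC n2 n1).
rewrite (econv_E1_S_ppos bw.1 x1) (econv_E1_S_ppos bNw.1 x1).
rewrite (rconvE kernel_of_1 bw HH) mulrBr.
rewrite (fineZ _ (econv_ppos_fin_num nH bw HH)).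
by rewrite (fineZ _ (econv_ppos_fin_num nH bNw HH)).
Qed.

Lemma rconv_S_1C (w : R -> R) (x : R) : bounded_measurable w -> x <= 1 ->
  rconv (fun t => kernelS (t / alpha)) (rconv (fun=> 1) w) x
  = rconv (fun=> 1) (rconv (fun t => kernelS (t / alpha)) w) x.
Proof.
move=> bw x1; have H1 := econv_heaviside_heaviside_lty 1; have [n2 c2 _] := kernel_of_S.
rewrite (rconv_assoc kernel_of_S kernel_of_1 bw econv_heaviside_S_lty H1 x1).
rewrite (rconv_assoc kernel_of_1 kernel_of_S bw H1 econv_heaviside_S_lty x1).
by rewrite (econvC n2 (@nnm_heaviside R)).
Qed.

(* Convolving with [S(./alpha)] inverts the fractional integral up to one
   integration, by associativity. *)
Lemma integral_eq_of_E1 (v w : R -> R) (x : R) :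
  bounded_measurable v -> bounded_measurable w -> x <= 1 ->
  {ae mu, forall y, 0 <= y <= 1 ->
    alpha^-1 * rconv (fun t => expint1 (t / alpha)) v y = rconv (fun=> 1) w y} ->
  rconv (fun=> 1) v x
  = rconv (fun=> 1) (rconv (fun t => kernelS (t / alpha)) w) x.
Proof.
move=> bv bw x1 ae.
have H1 := econv_heaviside_heaviside_lty 1.
have Sx : (econv heaviside ekerS x < +oo)%E.
  by apply: (econv_heaviside_lty _ x1 econv_heaviside_S_lty); case: kernel_of_S.
have bk := bounded_measurable_rconv kernel_of_E1 bv (econv_heaviside_E1_lty 1).
have b1 := bounded_measurable_rconv kernel_of_1 bw H1.
have an0 : alpha != 0 by rewrite gt_eqF.
(* With [E1] and [S] the rescaled kernels, the chain is [alpha (1 * v) = S * (E1 * v) = S * (alpha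
   (1 * w)) = alpha (1 * (S * w))]; its middle equality tolerates a hypothesis that holds only
   a.e. *)
apply: (mulfI an0).
rewrite -(rconv_S_E1 bv x1) -(rconv_S_1C bw x1).
rewrite -(rconv_restr01 _ (rconv _ v) x1) -(rconv_restr01 _ (rconv _ w) x1).
rewrite -(rconvZ alpha kernel_of_S b1 Sx).
have b1' : bounded_measurable (fun y => alpha * restr01 (rconv (fun=> 1) w) y).
  move: b1 => [m1 [M hM]]; split; first exact: measurable_funM.
  by exists (alpha * M) => y; rewrite normrM gtr0_norm// ler_pM2l.
apply: (ae_eq_rconv kernel_of_S bk b1').
move: ae; apply: filterS; first exact: (ae_filter_ringOfSetsType mu).
move=> y h /andP[y0 yx]; have y01 : 0 <= y <= 1 by rewrite (ltW y0)/=; lra.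
by rewrite !restr01E// -(h y01) mulrA mulfV ?mul1r// gt_eqF.
Qed.

End fractional_kernels.

(** * Continuity of convolutions *)

Section continuity.
Context {R : realType}.
Local Notation mu := (@lebesgue_measure R).

Lemma bounded_measurable_restr01 (u : R -> R) : {within `[0%R, 1%R], continuous u} ->
  bounded_measurable (restr01 u).
Proof.
move=> cu; split.
  apply/(measurable_restrictT _ _).1 => //.
  exact: subspace_continuous_measurable_fun.
have [c _ hc] := EVT_max ler01 cu; have [d _ hd] := EVT_min ler01 cu.
exists (`|u c| + `|u d|) => x; rewrite /restr01 patchE.
case: ifPn => [|_]; last by rewrite normr0 addr_ge0.
rewrite mem_setE => x01; have := hc x x01; have := hd x x01.
have := ler_norm (u c); have := ler_norm (- u d); rewrite normrN.
have := normr_ge0 (u c); have := normr_ge0 (u d).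
by rewrite ler_norml => *; apply/andP; split; lra.
Qed.

Lemma restr01_continuous (u : R -> R) z : {within `[0%R, 1%R], continuous u} ->
  z != 0 -> z != 1 -> {for z, continuous (restr01 u)}.
Proof.
move=> /(continuous_within_itvP _ ltr01)[cu _ _] z0 z1.
have [zn|zp] := ltP z 0.
  apply: (@near_cst_continuous _ _ 0); near=> y.
  rewrite /restr01 patchE mem_setE in_itv/= ifF//; apply/negbTE.
  rewrite negb_and -ltNge; apply/orP; left; near: y; exact: lt_nbhsl.
have [z1'|z1'] := ltP 1 z.
  apply: (@near_cst_continuous _ _ 0); near=> y.
  rewrite /restr01 patchE mem_setE in_itv/= ifF//; apply/negbTE.
  rewrite negb_and -!ltNge; apply/orP; right; near: y; exact: lt_nbhsr.
have zin : z \in `]0, 1[ by rewrite in_itv/= !lt_neqAle eq_sym z0 zp z1 z1'.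
have := cu z zin; rewrite /continuous_at.
rewrite -(@restr01E R u z) ?zp// => h.
apply: cvg_trans h; apply: near_eq_cvg; near=> y.
rewrite restr01E//.
have : y \in `]0, 1[ by near: y; exact: near_in_itvoo.
by rewrite in_itv/= => /andP[/ltW -> /ltW ->].
Unshelve. all: by end_near. Qed.

(** A continuous retraction onto [[0, 1]]: composing with it replaces continuity within [[0, 1]] by
    continuity on the line, and keeps arguments below 1, where finiteness is known. *)
Definition clip01 (x : R) : R := Num.max 0 (Num.min x 1).

Lemma clip01_in x : 0 <= clip01 x <= 1.
Proof. by rewrite /clip01 le_max lexx/= ge_max ler01 ge_min lexx orbT. Qed.

Lemma clip01_id x : 0 <= x <= 1 -> clip01 x = x.
Proof. by move=> /andP[x0 x1]; rewrite /clip01 min_l// max_r. Qed.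

Lemma clip01_continuous : continuous clip01.
Proof.
move=> x; apply: (@continuous_max R R (fun=> 0) (fun x => Num.min x 1)).
  exact: cst_continuous.
apply: (@continuous_min R R (fun x => x) (fun=> 1)); first exact: cvg_id.
exact: cst_continuous.
Qed.

Lemma ae_neq (x : R) : {ae mu, forall y, y != x}.
Proof.
exists [set x]; split => //; first exact: lebesgue_measure_set1.
by move=> y /= /negP; rewrite negbK => /eqP.
Qed.

Definition rpos (v : R -> R) (t : R) : R := if 0 < t then Num.max (v t) 0 else 0.

Lemma pposE (v : R -> R) : ppos v = EFin \o rpos v.
Proof.
apply/funext => t; rewrite /ppos /rpos /heaviside /=.
by case: ifP; rewrite ?mul1e ?mul0e.
Qed.

Lemma rpos_continuous (v : R -> R) z : z != 0 -> {for z, continuous v} ->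
  {for z, continuous (rpos v)}.
Proof.
move=> z0 cv; have [zn|zp] := ltP z 0.
  apply: (@near_cst_continuous _ _ 0); near=> y.
  rewrite /rpos ifF//; apply/negbTE; rewrite -leNgt; apply/ltW.
  by near: y; exact: lt_nbhsl.
have z1 : 0 < z by rewrite lt_neqAle eq_sym z0.
have h : {for z, continuous (fun t => Num.max (v t) 0)}.
  by apply: (@continuous_max R R v (fun=> 0)) => //; exact: cst_continuous.
rewrite /prop_for /continuous_at {2}/rpos z1; apply: cvg_trans h.
apply: near_eq_cvg; near=> y; rewrite /rpos ifT//; near: y; exact: lt_nbhsr.
Unshelve. all: by end_near. Qed.

(** The kernel is merely integrable, so it stays fixed and the moving variable is placed in the
    bounded factor. The values [v (xs n - y)] converge except possibly for [y = x] and [y = x - 1],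
    and dominated convergence applies. *)
Lemma econv_ppos_cvg (a : R -> \bar R) (v : R -> R) (xs : nat -> R) (x : R) :
  nnm a -> (econv heaviside a 1%R < +oo)%E -> bounded_measurable v ->
  (forall z, z != 0 -> z != 1 -> {for z, continuous v}) ->
  (forall n, xs n <= 1) -> x <= 1 -> xs n @[n --> \oo] --> x ->
  econv (ppos v) a (xs n) @[n --> \oo] --> econv (ppos v) a x.
Proof.
move=> na a1 [mv [M vM]] cv xs1 x1 xsx.
have np := nnm_ppos mv; have nH := @nnm_heaviside R.
have M0 : 0 <= M by exact: le_trans (vM 0).
have MM0 : (0 <= M%:E)%E by rewrite lee_fin.
(* As [xs n <= 1], only [y < 1] contributes, and there [a] is integrable. *)
pose g (y : R) : \bar R := (heaviside (1 - y)%R * a y)%E.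
have [mg g0] : nnm g by exact: (nnm_econv_integrand 1 nH na).
have ig : mu.-integrable setT g.
  apply/integrableP; split => //.
  by under eq_integral do rewrite gee0_abs//.
have iMg : mu.-integrable setT (fun y => M%:E * g y)%E by exact: integrableZl.
have [] := @dominated_convergence _ _ R mu setT measurableT
  (fun n y => ppos v (xs n - y)%R * a y)%E (fun y => ppos v (x - y)%R * a y)%E
  (fun y => M%:E * g y)%E.
- by move=> n; exact: (nnm_econv_integrand (xs n) np na).1.
- exact: (nnm_econv_integrand x np na).1.
- have := integrable_ae measurableT ig.
  move: (ae_neq x) (ae_neq (x - 1)).
  apply: (@filterS3 _ _ (ae_filter_ringOfSetsType mu)) => y yx yx1 /(_ I) gy _.
  have [y1|y1] := leP 1 y.
    have Z t : t <= 1 -> ppos v (t - y) = 0%E by move=> t1; rewrite causal_ppos//; lra.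
    rewrite (Z _ x1) mul0e; apply: cvg_near_cst; apply: nearW => n.
    by rewrite (Z _ (xs1 n)) mul0e.
  move: gy; rewrite /g /heaviside subr_gt0 y1 mul1e => ay.
  apply: cvgeZr => //; rewrite pposE; apply: cvg_EFin; first exact: nearW.
  have h : {for x - y, continuous (rpos v)}.
    apply: rpos_continuous; first by rewrite subr_eq0 eq_sym.
    apply: cv; first by rewrite subr_eq0 eq_sym.
    by apply: contra yx1 => /eqP <-; apply/eqP; ring.
  have hx : (xs n - y @[n --> \oo] --> x - y)%R by exact: (cvgB xsx (cvg_cst y)).
  exact: (cvg_comp _ _ hx h).
- exact: iMg.
- apply: aeW => y n _; rewrite gee0_abs; last exact: (nnm_econv_integrand (xs n) np na).2.
  rewrite /g muleA; apply: lee_wpmul2r; first exact: na.2.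
  apply: le_trans (ppos_le _ vM) _; apply: lee_wpmul2l => //.
  rewrite /heaviside; case: ifPn => // h; last by case: ifP.
  by rewrite ifT//; have := xs1 n; lra.
by move=> _ _.
Qed.

Lemma rconv_continuous (kap : R -> R) (a : R -> \bar R) (u : R -> R) :
  kernel_of kap a -> (econv heaviside a 1%R < +oo)%E ->
  {within `[0%R, 1%R], continuous u} ->
  {within `[0%R, 1%R], continuous (rconv kap u)}.
Proof.
move=> ka a1 cu; have [na ca _] := ka.
have bu := bounded_measurable_restr01 cu.
have bNu := bounded_measurableN bu.
have cv := fun z => @restr01_continuous u z cu.
have cvN z : z != 0 -> z != 1 -> {for z, continuous (fun y => - restr01 u y)}.
  by move=> z0 z1; apply: cvgN; exact: cv.
have half v : bounded_measurable v ->
  (forall z, z != 0 -> z != 1 -> {for z, continuous v}) ->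
  continuous (fun x => fine (econv (ppos v) a (clip01 x))).
  move=> bv cv' x; apply/(@cvg_nbhsP _ R^o) => xs xsx.
  apply: fine_cvg.
  have c1 t : clip01 t <= 1 by case/andP: (clip01_in t).
  have np := nnm_ppos bv.1.
  rewrite fineK; last first.
    rewrite (econvC np na); apply: (econv_ppos_fin_num na bv).
    exact: econv_heaviside_lty.
  apply: econv_ppos_cvg => //.
  by apply: cvg_comp xsx _; exact: clip01_continuous.
pose F x := fine (econv (ppos (restr01 u)) a (clip01 x))
  - fine (econv (ppos (fun y => - restr01 u y)) a (clip01 x)).
have cF : continuous F.
  by move=> x; apply: cvgB; [exact: half|exact: half].
apply: (subspace_eq_continuous _ (continuous_subspaceT cF)) => x.
rewrite inE/= in_itv/= => x01; change (F x = rconv kap u x); rewrite /F clip01_id//.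
have [x0 x1] := andP x01.
rewrite -(rconv_restr01 _ _ x1) (rconvE ka bu (econv_heaviside_lty na x1 a1)).
by rewrite (econvC na (nnm_ppos bu.1)) (econvC na (nnm_ppos bNu.1)).
Qed.

End continuity.

(** * Absolutely continuous functions *)

Section absolutely_continuous.
Context {R : realType}.
Local Notation mu := (@lebesgue_measure R).

Lemma ac_small_increment (a b : R) (g : R -> R) : abs_continuous a b g ->
  forall e, 0 < e -> exists2 d, 0 < d & forall x y, a <= x -> x <= y -> y <= b ->
    y - x < d -> `|g y - g x| < e.
Proof.
move=> ac e e0; have [d d0 H] := ac e e0; exists d => // x y ax xy yb yxd.
have := H 1%N (fun=> x) (fun=> y); rewrite !big_ord1; apply => //.
by move=> i j _ _ _; rewrite !ord1.
Qed.

Lemma ac_sub (a b : R) (g h : R -> R) : abs_continuous a b g -> abs_continuous a b h ->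
  abs_continuous a b (fun x => g x - h x).
Proof.
move=> acg ach e e0; have e20 : 0 < e / 2 by lra.
have [d1 d10 H1] := acg _ e20; have [d2 d20 H2] := ach _ e20.
exists (Num.min d1 d2); first by rewrite lt_min d10.
move=> n l r lr tr; rewrite lt_min => /andP[s1 s2].
have h1 := H1 n l r lr tr s1; have h2 := H2 n l r lr tr s2.
apply: (@le_lt_trans _ _ (\sum_(i < n) (`|g (r i) - g (l i)| + `|h (r i) - h (l i)|))).
  apply: ler_sum => i _.
  rewrite (_ : _ - _ - _ = (g (r i) - g (l i)) - (h (r i) - h (l i))); last by ring.
  exact: ler_normB.
by rewrite big_split/=; lra.
Qed.

Lemma lipschitz_ac (a b M : R) (g : R -> R) :
  (forall x y, a <= x -> x <= y -> y <= b -> `|g y - g x| <= M * (y - x)) ->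
  abs_continuous a b g.
Proof.
move=> H e e0; have M0 : 0 < `|M| + 1 by have := normr_ge0 M; lra.
exists (e / (`|M| + 1)); first exact: divr_gt0.
move=> n l r lr _; rewrite ltr_pdivlMr// => s.
apply: le_lt_trans s; rewrite mulr_suml; apply: ler_sum => i _.
have [li [lri rb]] := lr i; apply: le_trans (H _ _ li lri rb) _.
rewrite mulrC ler_wpM2l ?subr_ge0//; have := ler_norm M; lra.
Qed.

Lemma derivable0_increment (h : R -> R) (c e : R) : 0 < e -> derivable h c 1 ->
  derive1 h c = 0 ->
  exists2 d, 0 < d & forall z, `|z - c| < d -> `|h z - h c| <= e * `|z - c|.
Proof.
move=> e0 dh; rewrite derive1E => h0.
have : (fun t => t^-1 *: ((h \o shift c) (t *: 1) - h c)) @ 0^' --> 'D_1 h c.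
  exact: dh.
rewrite h0 => /cvgrPdist_le/(_ e e0) => [[d /= d0 H]].
exists d => // z zc; have [->|zc0] := eqVneq z c; first by rewrite !subrr normr0 mulr0.
have z0 : z - c != 0 by rewrite subr_eq0.
have := H (z - c); rewrite /= sub0r normrN => /(_ zc z0).
rewrite sub0r normrN /= /GRing.scale/= mulr1 subrK normrM normfV.
by rewrite ler_pdivrMl ?normr_gt0// mulrC.
Qed.

(** Inclusion of the intervals in [U] is not recorded, only their total length against the measure
    of [U] below [x]. This survives the addition of []x, y[] inside [U] and is all that absolute
    continuity needs. *)
Definition chain (U : set R) (x : R) (s : seq (R * R)) : Prop :=
  [/\ all (fun p => [&& 0 <= p.1, p.1 <= p.2 & p.2 <= x]) s,
      pairwise (fun p q => p.2 <= q.1) s &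
      ((\sum_(p <- s) (p.2 - p.1))%:E <= mu (U `&` `]-oo, x[))%E].

Lemma chain_widen (U : set R) (x y : R) s : measurable U -> x <= y ->
  chain U x s -> chain U y s.
Proof.
move=> mU xy [h1 h2 h3]; split => //.
  apply: sub_all h1 => p /and3P[-> -> h]/=; exact: le_trans xy.
apply: le_trans h3 _; apply: le_measure; rewrite ?inE.
- exact: measurableI.
- exact: measurableI.
by apply: setIS; apply: subset_itvl; rewrite bnd_simp.
Qed.

Lemma chain_rcons (U : set R) (x y : R) s : measurable U -> 0 <= x -> x <= y ->
  `]x, y[ `<=` U -> chain U x s -> chain U y (rcons s (x, y)).
Proof.
move=> mU x0 xy xyU cs; have [h1 h2 h3] := cs.
have [k1 _ _] := chain_widen mU xy cs.
split.
- by rewrite all_rcons/= x0 xy lexx.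
- rewrite pairwise_rcons h2 andbT; apply: sub_all h1 => p /and3P[_ _]//.
rewrite -cats1 big_cat big_seq1/= EFinD.
apply: (@le_trans _ _ (mu (U `&` `]-oo, x[) + mu `]x, y[)%E).
  apply: leeD => //; rewrite lebesgue_measure_itv/= lte_fin.
  case: ifPn => [_|]; first by rewrite -EFinD.
  by rewrite -leNgt lee_fin subr_le0.
rewrite -measureU//.
- apply: le_measure; rewrite ?inE.
  + by apply: measurableU => //; exact: measurableI.
  + exact: measurableI.
  move=> z [[Uz]|]/=; rewrite !in_itv/=.
    by move=> zx; split => //=; exact: lt_le_trans xy.
  move=> /andP[xz zy]; split; last exact: zy.
  by apply: xyU; rewrite /= in_itv/= xz.
- exact: measurableI.
apply/seteqP; split => z//= [[_]]; rewrite !in_itv/= => zx /andP[xz _].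
by have := lt_trans zx xz; rewrite ltxx.
Qed.

Lemma chain_ac (U : set R) (h : R -> R) (x d e : R) s :
  (forall (n : nat) (l r : 'I_n -> R),
      (forall i, 0 <= l i /\ l i <= r i /\ r i <= 1) ->
      trivIset [set: 'I_n] (fun i => `](l i), (r i)[%classic) ->
      \sum_(i < n) (r i - l i) < d ->
      \sum_(i < n) `|h (r i) - h (l i)| < e) ->
  x <= 1 -> measurable U -> (mu U < d%:E)%E -> chain U x s ->
  \sum_(p <- s) `|h p.2 - h p.1| < e.
Proof.
move=> H x1 mU Ud [h1 h2 h3].
rewrite (big_nth (0, 0)) big_mkord; apply: H.
- move=> i; have := all_nthP (0, 0) h1 i (ltn_ord i) => /and3P[-> -> hp]; split => //.
  by split => //; exact: le_trans x1.
- have lt_disj (i j : 'I_(size s)) z : (i < j)%N ->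
      z \in `]((nth (0, 0) s i).1), ((nth (0, 0) s i).2)[ ->
      z \in `]((nth (0, 0) s j).1), ((nth (0, 0) s j).2)[ -> False.
    move=> ij; rewrite !in_itv/= => /andP[_ z1] /andP[z2 _].
    have /(_ i j) := pairwiseP (0, 0) h2; rewrite !inE !ltn_ord => /(_ isT isT ij).
    by move=> /(lt_le_trans z1) /(lt_trans z2); rewrite ltxx.
  move=> i j _ _ [z [zi zj]]; apply/val_inj/eqP; case: ltngtP => // ij.
    by case: (lt_disj _ _ _ ij zi zj).
  by case: (lt_disj _ _ _ ij zj zi).
rewrite -lte_fin; apply: le_lt_trans Ud; apply: le_trans.
  apply: le_trans h3; rewrite (big_nth (0, 0)) big_mkord; exact: lexx.
apply: le_measure; rewrite ?inE//; first exact: measurableI.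
Qed.

(* Cousin's lemma in disguise: the points reachable from [0] by intervals that
   are either tagged at a point of derivability, or inside a small open set
   containing the exceptional null set, form a set with no supremum below [b]. *)
Lemma ac_derive0_cst (h : R -> R) : abs_continuous 0 1 h ->
  {ae mu, forall t, 0 <= t <= 1 -> derivable h t 1 /\ derive1 h t = 0} ->
  forall b, 0 <= b <= 1 -> h b = h 0.
Proof.
move=> ac [N [mN N0 dN]] b /andP[b0 b1].
(* One [e] pays for a slope at most [e] over a length at most 1, the other for the increments along
   the chain, by absolute continuity. *)
suff small e : 0 < e -> `|h b - h 0| <= e + e.
  apply/eqP; rewrite -subr_eq0 -normr_le0; apply/ler_addgt0Pr => e e0.
  by rewrite add0r [leRHS]splitr; apply: small; lra.
move=> e0; have [d d0 Hd] := ac e e0.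
have [U [oU NU Ud]] : exists U : set R, [/\ open U, N `<=` U & (mu U < d%:E)%E].
  have [|U [oU NU Ud]] := lebesgue_regularity_outer mN _ d0; first by move: N0 => /= ->; exact: ltry.
  exists U; split => //; apply: le_lt_trans Ud.
  have mU : measurable U by exact: open_measurable.
  rewrite -[leRHS]adde0 -[X in (_ + X)%E]N0.
  apply: (@le_trans _ _ (mu ((U `\` N) `|` N))).
    apply: le_measure; rewrite ?inE//; first by apply: measurableU => //; exact: measurableD.
    by move=> z Uz; have [Nz|Nz] := pselect (N z); [right|left].
  by apply: measureU2 => //; exact: measurableD.
have mU : measurable U by exact: open_measurable.
pose E := [set x | 0 <= x <= b /\ exists2 s, chain U x s &
  `|h x - h 0| <= e * x + \sum_(p <- s) `|h p.2 - h p.1|].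
have E0 : E 0.
  split; first by rewrite lexx.
  exists [::]; first by split => //; rewrite big_nil measure_ge0.
  by rewrite big_nil subrr normr0 mulr0 addr0.
(* Only steps from [x <= c] to [y >= c] are needed. If [c] is exceptional, []x, y[] lies in [U] and
   joins the chain. Otherwise the increments on both sides of [c] have slope at most [e], and the
   chain is unchanged. *)
have step c : 0 <= c <= b -> exists2 r, 0 < r &
    forall x y, E x -> c - r < x -> x <= c -> c <= y -> y < c + r -> y <= b -> E y.
  move=> /andP[c0 cb]; have [Nc|Nc] := pselect (N c).
    have /nbhs_ballP[r /= r0 rU] : nbhs c U by apply: open_nbhs_nbhs; split => //; exact: NU.
    exists r => // x y [/andP[x0 xb] [s cs hs]] cx xc cy yc yb; split.
      by rewrite (le_trans c0 cy).
    have xy := le_trans xc cy.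
    exists (rcons s (x, y)).
      apply: chain_rcons => // z; rewrite /= in_itv/= => /andP[xz zy].
      by apply: rU; rewrite /ball/= ltr_distlC; apply/andP; split; lra.
    rewrite -cats1 big_cat big_seq1/=.
    have := ler_normD (h x - h 0) (h y - h x).
    rewrite (_ : h x - h 0 + (h y - h x) = h y - h 0); last by ring.
    have : e * x <= e * y by rewrite ler_pM2l.
    lra.
  have [dh h'c] : derivable h c 1 /\ derive1 h c = 0.
    have /contrapT := contra_not (dN c) Nc; apply.
    by rewrite c0 (le_trans cb b1).
  have [r r0 hr] := derivable0_increment e0 dh h'c.
  exists r => // x y [/andP[x0 xb] [s cs hs]] cx xc cy yc yb; split.
    by rewrite (le_trans c0 cy).
  exists s; first exact: (chain_widen mU (le_trans xc cy)).
  have hx : `|h x - h c| <= e * `|x - c| by apply: hr; rewrite ltr_distlC; apply/andP; split; lra.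
  have hy : `|h y - h c| <= e * `|y - c| by apply: hr; rewrite ltr_distlC; apply/andP; split; lra.
  have xcE : `|x - c| = c - x by rewrite ler0_norm ?subr_le0// opprB.
  have ycE : `|y - c| = y - c by rewrite ger0_norm ?subr_ge0.
  rewrite xcE in hx; rewrite ycE in hy.
  have := ler_normD (h x - h 0) (h y - h x).
  rewrite (_ : h x - h 0 + (h y - h x) = h y - h 0); last by ring.
  have := ler_normB (h y - h c) (h x - h c).
  rewrite (_ : h y - h c - (h x - h c) = h y - h x); last by ring.
  lra.
have ubE : has_ubound E by exists b => x [/andP[]].
pose c := sup E.
have c0 : 0 <= c by apply: (ub_le_sup ubE).
have cb : c <= b by apply: ge_sup; [exists 0|move=> x [/andP[]]].
have [r r0 st] := step c (introT andP (conj c0 cb)).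
have [x Ex xc] : exists2 x, E x & c - r < x.
  by apply: sup_adherent => //; split; [exists 0|].
have xc' : x <= c by exact: (ub_le_sup ubE).
have [cb'|cb'] := ltP c b.
  (* A point of [E] strictly beyond its supremum, unless [c = b]. *)
  have Ey : E (Num.min b (c + r / 2)).
    have c1 : c < c + r / 2 by rewrite ltrDl divr_gt0.
    apply: (st x) => //; first by rewrite le_min cb (ltW c1).
      by rewrite gt_min; apply/orP; right; lra.
    by rewrite ge_min lexx.
  have := ub_le_sup ubE Ey; rewrite -/c leNgt lt_min cb'/=; lra.
have [_ [s cs hs]] : E b by apply: (st x) => //; lra.
have := chain_ac Hd b1 mU Ud cs; have : e * b <= e by rewrite ler_piMr// ltW.
lra.
Qed.

End absolutely_continuous.

(** * Solutions as fixed points *)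

Section solutions.
Context {R : realType}.
Local Notation mu := (@lebesgue_measure R).
Local Notation int0 := (rconv (fun=> 1 : R)).

Lemma within01_eq (f g : R -> R) : {within `[0%R, 1%R], continuous f} ->
  {within `[0%R, 1%R], continuous g} -> (forall t, 0 < t < 1 -> f t = g t) ->
  forall t, 0 <= t <= 1 -> f t = g t.
Proof.
move=> /(continuous_within_itvP _ ltr01)[_ f0 f1].
move=> /(continuous_within_itvP _ ltr01)[_ g0 g1] fg t /andP[].
rewrite le_eqVlt => /predU1P[<- _|t0].
  apply: (cvg_unique _ f0) => //; apply: cvg_trans g0; apply: near_eq_cvg.
  near=> y; apply/esym/fg; apply/andP; split; near: y; first exact: nbhs_right_gt.
  exact: nbhs_right_lt.
rewrite le_eqVlt => /predU1P[->|t1]; last by apply: fg; rewrite t0.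
apply: (cvg_unique _ f1) => //; apply: cvg_trans g1; apply: near_eq_cvg.
near=> y; apply/esym/fg; apply/andP; split; near: y; first exact: nbhs_left_gt.
exact: nbhs_left_lt.
Unshelve. all: by end_near. Qed.

Lemma int0E (w : R -> R) x : {within `[0%R, 1%R], continuous w} -> x <= 1 ->
  int0 w x = \int[mu]_(y in `]0%R, x]) restr01 w y.
Proof.
move=> cw x1; have bw := bounded_measurable_restr01 cw.
rewrite -(rconv_restr01 _ _ x1) -Rintegral_itv_bndo_bndc.
  by apply: eq_Rintegral => y _; rewrite mul1r.
have := integrable_rconv kernel_of_1 bw (econv_heaviside_heaviside_lty x).
by under [X in EFin \o X]eq_fun do rewrite mul1r.
Qed.

Lemma int0_derivable (w : R -> R) t : {within `[0%R, 1%R], continuous w} ->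
  0 < t < 1 -> derivable (int0 w) t 1 /\ derive1 (int0 w) t = w t.
Proof.
move=> cw /andP[t0 t1]; have bw := bounded_measurable_restr01 cw.
have iw : mu.-integrable `]0%R, 1%R] (EFin \o restr01 w).
  apply: (@integrableS _ _ _ mu `]0%R, 2%R[) => //.
    by apply: subset_itvl; rewrite bnd_simp; lra.
  have := integrable_rconv kernel_of_1 bw (econv_heaviside_heaviside_lty 2).
  by under [X in EFin \o X]eq_fun do rewrite mul1r.
have cwt : {for t, continuous (restr01 w)}.
  by apply: restr01_continuous => //; [rewrite gt_eqF|rewrite lt_eqF].
have [|dF FE] := continuous_FTC1 t1 iw _ cwt; first exact: t0.
have nE : \forall y \near t, (fun x => \int[mu]_(s in `]0%R, x]) restr01 w s) y = int0 w y.
  near=> y; rewrite int0E//; apply/ltW; near: y; exact: lt_nbhsl.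
split; first exact: near_eq_derivable nE dF.
rewrite derive1E -(near_eq_derive _ nE) -derive1E FE restr01E//.
by rewrite (ltW t0) (ltW t1).
Unshelve. all: by end_near. Qed.

Lemma int0_continuous (w : R -> R) : {within `[0%R, 1%R], continuous w} ->
  {within `[0%R, 1%R], continuous (int0 w)}.
Proof.
by apply: (rconv_continuous kernel_of_1); exact: econv_heaviside_heaviside_lty.
Qed.

Lemma int0_ac (w : R -> R) : {within `[0%R, 1%R], continuous w} ->
  abs_continuous 0 1 (int0 w).
Proof.
move=> cw; have [_ [M wM]] := bounded_measurable_restr01 cw.
apply: (@lipschitz_ac R 0 1 M) => x y x0 xy y1.
have dW t : t \in `]x, y[ -> is_derive t 1 (int0 w) (w t).
  rewrite in_itv/= => /andP[xt ty].
  have [|d1 d2] := @int0_derivable w t cw; first by apply/andP; split; lra.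
  by apply: DeriveDef; [exact: d1|rewrite -derive1E; exact: d2].
have cW : {within `[x, y], continuous (int0 w)}.
  apply: continuous_subspaceW (int0_continuous cw); apply: subset_itv; rewrite bnd_simp//.
have [c] := MVT_segment xy dW cW.
rewrite in_itv/= => /andP[xc cy] ->.
rewrite normrM ler_pM ?normr_ge0//; last by rewrite ger0_norm ?subr_ge0.
by rewrite -(@restr01E R w c)//; apply/andP; split; lra.
Qed.

Lemma int00 (w : R -> R) : int0 w 0 = 0.
Proof. by rewrite /rconv set_itv_ge ?Rintegral_set0// bnd_simp ltxx. Qed.

Lemma ae_exists_itv (P : R -> Prop) (a b : R) : 0 <= a -> a < b -> b <= 1 ->
  {ae mu, forall x, 0 <= x <= 1 -> P x} -> exists2 y, a < y < b & P y.
Proof.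
move=> a0 ab b1 [N [mN N0 PN]]; apply: contrapT => H.
have sub : `]a, b[ `<=` N.
  move=> y; rewrite /= in_itv/= => ayb; apply: PN => /= Py.
  apply: H; exists y => //; apply: Py; move/andP: ayb => [ay yb].
  by apply/andP; split; lra.
have : (mu `]a, b[ <= mu N)%E by apply: le_measure; rewrite ?inE.
rewrite [X in (_ <= X)%E]N0 lebesgue_measure_itv/= lte_fin ab -EFinD lee_fin; lra.
Qed.

(** A null set contains no nondegenerate interval, so every point of [[0, 1]] is arbitrarily close
    to one where the functions agree, and small increments do the rest. This makes the choice in
    [ac_rep] immaterial on [[0, 1]]. *)
Lemma ac_ae_eq (g1 g2 : R -> R) : abs_continuous 0 1 g1 -> abs_continuous 0 1 g2 ->
  {ae mu, forall x, 0 <= x <= 1 -> g1 x = g2 x} ->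
  forall x, 0 <= x <= 1 -> g1 x = g2 x.
Proof.
move=> ac1 ac2 ae x /andP[x0 x1]; apply/eqP; rewrite -subr_eq0 -normr_le0.
apply/ler_addgt0Pr => e e0; rewrite add0r.
have [d d0 H] := ac_small_increment (ac_sub ac1 ac2) e0.
have [x2|x2] := ltP x 1.
  have [||y /andP[xy yb] gy] := ae_exists_itv x0 (b := Num.min 1 (x + d)) _ _ ae.
  - by rewrite lt_min x2 ltrDl.
  - by rewrite ge_min lexx.
  move: yb; rewrite lt_min => /andP[y1 yd].
  have := H x y x0 (ltW xy) (ltW y1); rewrite gy subrr sub0r normrN => h.
  by apply/ltW/h; lra.
have [|||y /andP[yb xy] gy] := @ae_exists_itv _ (Num.max 0 (x - d)) x _ _ _ ae => //.
- by rewrite le_max lexx.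
- by rewrite gt_max; apply/andP; split; lra.
move: yb; rewrite gt_max => /andP[y0 yd].
have := H y x (ltW y0) (ltW xy) x1; rewrite gy subrr subr0 => h.
by apply/ltW/h; lra.
Qed.

Lemma ac_rep_eq (h W : R -> R) : is_ac_rep h W ->
  forall x, 0 <= x <= 1 -> ac_rep h x = W x.
Proof.
move=> hW; have [acg aeg] : is_ac_rep h (ac_rep h) by exact: (xgetPex h (ex_intro _ W hW)).
have [acW aeW] := hW; apply: ac_ae_eq => //.
move: aeg aeW; apply: (@filterS2 _ _ (ae_filter_ringOfSetsType mu)) => x h1 h2 x01.
by rewrite -h1// h2.
Qed.

(** The difference with the primitive of [w] is absolutely continuous with zero derivative a.e.; the
    endpoints, where that primitive need not be derivable, are discarded as a null set. *)
Lemma ac_derive_int0 (g w : R -> R) : {within `[0%R, 1%R], continuous w} ->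
  abs_continuous 0 1 g -> g 0 = 0 ->
  {ae mu, forall t, 0 <= t <= 1 -> derivable g t 1 /\ derive1 g t = w t} ->
  forall x, 0 <= x <= 1 -> g x = int0 w x.
Proof.
move=> cw acg g0 dg x x01; apply/eqP; rewrite -subr_eq0; apply/eqP.
rewrite [LHS](ac_derive0_cst (ac_sub acg (int0_ac cw)) _ x01) ?int00 ?g0 ?subrr//.
move: dg (@ae_neq R 0) (@ae_neq R 1).
apply: (@filterS3 _ _ (ae_filter_ringOfSetsType mu)) => t h t0 t1 t01.
have [d1 d2] := h t01.
have t01' : 0 < t < 1.
  by move/andP: t01 => [a b]; rewrite !lt_neqAle a b eq_sym t0 t1.
have [d3 d4] := int0_derivable cw t01'.
split; first exact: derivableB.
by rewrite derive1E (deriveB d1 d3) -!derive1E d2 d4 subrr.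
Qed.

Variables (alpha lambda : R) (f : R -> R -> R).
Hypothesis alpha0 : 0 < alpha.
Hypothesis HS : (econv heaviside (@eS R) alpha^-1 < +oo)%E.
Hypothesis cf : {within `[0%R, 1%R] `*` [set: R], continuous (fun p : R * R => f p.1 p.2)}.

Definition rhs (u : R -> R) (y : R) : R := - lambda * u y + f y (u y).

Lemma rhs_continuous (u : R -> R) : {within `[0%R, 1%R], continuous u} ->
  {within `[0%R, 1%R], continuous (rhs u)}.
Proof.
move=> cu; apply/subspace_continuousP => x x01.
have hu := (subspace_continuousP _ _).1 cu x x01.
apply: cvgD; first by apply: cvgM; [exact: cvg_cst|exact: hu].
have hf := (subspace_continuousP _ _).1 cf (x, u x) (conj x01 I).
have h : (fun y => (y, u y)) @ within `[0%R, 1%R] (nbhs x) -->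
    within (`[0%R, 1%R] `*` [set: R]) (nbhs (x, u x)).
  have hx : (fun y : R => y) @ within `[0%R, 1%R] (nbhs x) --> x.
    exact: cvg_within_filter.
  move=> P wP.
  have A : within `[0%R, 1%R] (nbhs x) (fun y : R =>
      (`[0%R, 1%R] `*` [set: R]) (y, u y) -> P (y, u y)) by exact: (cvg_pair hx hu wP).
  have B : within `[0%R, 1%R] (nbhs x) `[0%R, 1%R]%classic by exact: withinT.
  have : within `[0%R, 1%R] (nbhs x) (fun y : R => P (y, u y)).
    by apply: filterS2 A B => y h y01; apply: h; split.
  exact.
exact: (cvg_comp _ _ h hf).
Qed.

Lemma restr01_rconv_congr (kap v w : R -> R) x : x <= 1 ->
  (forall y, 0 <= y <= 1 -> v y = w y) -> rconv kap v x = rconv kap w x.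
Proof.
move=> x1 vw; apply: eq_rconv => y /andP[y0 yx]; apply: vw.
by apply/andP; split; lra.
Qed.

Local Notation convS := (rconv (fun t => kernelS (t / alpha))).
Local Notation convE1 := (rconv (fun t => expint1 (t / alpha))).

Lemma convS_continuous (w : R -> R) : {within `[0%R, 1%R], continuous w} ->
  {within `[0%R, 1%R], continuous (convS w)}.
Proof.
by apply: (rconv_continuous (kernel_of_S alpha0)); exact: econv_heaviside_S_lty.
Qed.

(** The representative of the fractional integral of [u] is the primitive of [rhs u]. Convolving
    with [S] gives [u] and [convS (rhs u)] the same primitive. As both are continuous,
    differentiation settles []0, 1[] and continuity the endpoints. *)
Lemma solution_fixed (u : R -> R) : is_solution alpha lambda f u ->
  forall t, 0 <= t <= 1 -> u t = convS (rhs u) t.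
Proof.
move=> [cu hac eqn g0]; have cw := rhs_continuous cu.
have [acg aeg] : is_ac_rep (frac_int alpha u) (ac_rep (frac_int alpha u)).
  by exact: (xgetPex _ hac).
have gE : forall x, 0 <= x <= 1 -> ac_rep (frac_int alpha u) x = int0 (rhs u) x.
  apply: (ac_derive_int0 cw acg g0).
  move: eqn; apply: filterS; first exact: (ae_filter_ringOfSetsType mu).
  move=> t h t01; have [h1 h2] := h t01; split; first exact: h1.
  by rewrite /rhs -h2 /frac_deriv mulNr addrC addrK.
have bu := bounded_measurable_restr01 cu; have bw := bounded_measurable_restr01 cw.
have ae : {ae mu, forall y, 0 <= y <= 1 ->
    alpha^-1 * convE1 (restr01 u) y = int0 (restr01 (rhs u)) y}.
  move: aeg; apply: filterS; first exact: (ae_filter_ringOfSetsType mu).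
  move=> y h y01; have /andP[_ y1] := y01.
  by rewrite !rconv_restr01// -gE// -h.
have cS := convS_continuous cw.
apply: within01_eq => // t /andP[t0 t1].
have [|_ <-] := int0_derivable (t := t) cu; first by rewrite t0.
have [|_ <-] := int0_derivable (t := t) cS; first by rewrite t0.
rewrite !derive1E; apply: near_eq_derive; near=> x.
have x1 : x <= 1 by apply/ltW; near: x; exact: lt_nbhsl.
rewrite -(rconv_restr01 _ u x1) (integral_eq_of_E1 alpha0 HS bu bw x1 ae).
apply: restr01_rconv_congr => // y /andP[_ y1].
exact: rconv_restr01.
Unshelve. all: by end_near. Qed.

(** Substituting [u = convS (rhs u)], the Sonine identity turns the fractional integral of [u] into
    the primitive of [rhs u], which serves as the representative. *)
Lemma fixed_solution (u : R -> R) : {within `[0%R, 1%R], continuous u} ->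
  (forall t, 0 <= t <= 1 -> u t = convS (rhs u) t) -> is_solution alpha lambda f u.
Proof.
move=> cu ufix; have cw := rhs_continuous cu.
have bw := bounded_measurable_restr01 cw.
have JW x : 0 <= x <= 1 -> frac_int alpha u x = int0 (rhs u) x.
  move=> /andP[x0 x1].
  have -> : frac_int alpha u x = alpha^-1 * convE1 u x by [].
  rewrite -(rconv_restr01 _ (rhs u) x1).
  have -> : convE1 u x = convE1 (convS (restr01 (rhs u))) x.
    apply: restr01_rconv_congr => // y y01; have /andP[_ y1] := y01.
    by rewrite rconv_restr01// ufix.
  by rewrite rconv_E1_S// mulrA mulVf ?mul1r// gt_eqF.
have rep : is_ac_rep (frac_int alpha u) (int0 (rhs u)).
  by split; [exact: int0_ac|apply: aeW => x /JW].
have gE := ac_rep_eq rep.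
split => //.
- by exists (int0 (rhs u)).
(* Endpoints are set aside: derivability is two-sided, and [ac_rep] is determined on [[0, 1]]
   only. *)
- move: (@ae_neq R 0) (@ae_neq R 1).
  apply: (@filterS2 _ _ (ae_filter_ringOfSetsType mu)) => t tn0 tn1 t01.
  have /andP[t0 t1] : 0 < t < 1.
    by move/andP: t01 => [a b]; rewrite !lt_neqAle a b eq_sym tn0 tn1.
  have nE : \forall y \near t, int0 (rhs u) y = ac_rep (frac_int alpha u) y.
    near=> y; rewrite gE//; apply/andP; split; apply/ltW; near: y.
      exact: lt_nbhsr.
    exact: lt_nbhsl.
  have [|d1 d2] := int0_derivable (t := t) cw; first by rewrite t0.
  split; first exact: near_eq_derivable nE d1.
  rewrite /frac_deriv derive1E -(near_eq_derive _ nE) -derive1E d2 /rhs mulNr.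
  by rewrite addrC addNKr.
- by rewrite gE ?int00// lexx ler01.
Unshelve. all: by end_near. Qed.

Lemma picardE (u : R -> R) t : picard alpha lambda f u t = convS (rhs u) t.
Proof.
rewrite /picard; case: ifPn => // t0.
by rewrite /rconv set_itv_ge ?Rintegral_set0// bnd_simp.
Qed.

End solutions.

(** * Picard iteration *)

Section picard_iteration.
Context {R : realType}.

Lemma uniform_cvg_geometric (A : set R) (u : nat -> R -> R) (l : R -> R) (q K : R) :
  0 <= q < 1 -> (forall n t, A t -> `|l t - u n t| <= q ^+ n * K) ->
  {uniform A, u @ \oo --> l}.
Proof.
move=> /andP[q0 q1] H P /uniform_nbhs[E [entE sub]].
move: entE; rewrite -entourage_ballE => -[e /= e0 eE].
have cv : (q ^+ n * K) @[n --> \oo] --> (0 : R).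
  rewrite -[X in _ --> X](mul0r K); apply: cvgM; last exact: cvg_cst.
  by apply: cvg_expr; rewrite ger0_norm.
move/cvgrPdist_lt : cv => /(_ e e0) [N _ HN].
exists N => // n Nn; apply: sub => t At; apply: eE; rewrite /= /ball/=.
apply: le_lt_trans (H n t At) _.
have := HN n Nn; rewrite /= sub0r normrN; apply: le_lt_trans; exact: ler_norm.
Qed.

Section contraction.
Variables (T : (R -> R) -> R -> R) (q : R).
Hypothesis q01 : 0 <= q < 1.
Local Notation cont01 u := ({within `[0%R, 1%R], continuous (u : R -> R)}).
Hypothesis T_cont : forall u : R -> R, cont01 u -> cont01 (T u).
Hypothesis T_contr : forall (u v : R -> R) (M : R), cont01 u -> cont01 v ->
  (forall t, 0 <= t <= 1 -> `|u t - v t| <= M) ->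
  forall t, 0 <= t <= 1 -> `|T u t - T v t| <= q * M.

Lemma iter_cont n (u : R -> R) : cont01 u -> cont01 (iter n T u).
Proof. by move=> cu; elim: n => //= n; exact: T_cont. Qed.

Lemma iter_contraction (u v : R -> R) (M : R) n : cont01 u -> cont01 v ->
  (forall t, 0 <= t <= 1 -> `|u t - v t| <= M) ->
  forall t, 0 <= t <= 1 -> `|iter n T u t - iter n T v t| <= q ^+ n * M.
Proof.
move=> cu cv uv; elim: n => [t t01|n IH t t01]; first by rewrite expr0 mul1r uv.
by rewrite exprS -mulrA; apply: T_contr => //; exact: iter_cont.
Qed.

Lemma cont01_dist_bounded (u v : R -> R) : cont01 u -> cont01 v ->
  exists2 M, 0 <= M & forall t, 0 <= t <= 1 -> `|u t - v t| <= M.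
Proof.
move=> cu cv; have [_ [A hA]] := bounded_measurable_restr01 cu.
have [_ [B hB]] := bounded_measurable_restr01 cv.
exists (A + B) => [|t t01].
  by apply: addr_ge0; [exact: le_trans (hA 0)|exact: le_trans (hB 0)].
rewrite -(restr01E u t01) -(restr01E v t01).
exact: le_trans (ler_normB _ _) (lerD (hA t) (hB t)).
Qed.

(** The exact geometric sum is kept, since with the weaker bound [q ^+ n * (M / (1 - q))] the
    induction on [m] would not close. *)
Lemma iter_tail_bound (u : R -> R) (M : R) n m : cont01 u ->
  (forall t, 0 <= t <= 1 -> `|T u t - u t| <= M) -> forall t, 0 <= t <= 1 ->
  `|iter (n + m) T u t - iter n T u t| <= (q ^+ n - q ^+ (n + m)) * (M / (1 - q)).
Proof.
move=> cu uM; have /andP[q0 q1] := q01.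
have q1' : 1 - q != 0 by rewrite subr_eq0 gt_eqF.
elim: m => [t t01|m IH t t01]; first by rewrite addn0 !subrr normr0 mul0r.
have h := iter_contraction (n + m) (T_cont cu) cu uM t01.
rewrite -iterSr in h.
rewrite addnS.
rewrite (_ : _ - _ = (iter (n + m).+1 T u t - iter (n + m) T u t)
  + (iter (n + m) T u t - iter n T u t)); last by ring.
apply: le_trans (ler_normD _ _) _; apply: le_trans (lerD h (IH t t01)) _.
rewrite exprS [leRHS](_ : _ = q ^+ (n + m) * M
  + (q ^+ n - q ^+ (n + m)) * (M / (1 - q)))//; by field.
Qed.

(** Completeness is used pointwise, in [R]. The geometric bound does not depend on [t], so the
    pointwise limit is also uniform and inherits continuity. *)
Lemma contraction_fixpoint : exists2 l : R -> R, cont01 l &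
  forall t, 0 <= t <= 1 -> T l t = l t.
Proof.
have /andP[q0 q1] := q01; have q1' : 0 < 1 - q by rewrite subr_gt0.
pose u0 : R -> R := fun=> 0.
have c0 : cont01 u0 by apply: continuous_subspaceT; exact: cst_continuous.
have [M M0 hM] := cont01_dist_bounded (T_cont c0) c0.
pose K := M / (1 - q); have K0 : 0 <= K by rewrite divr_ge0// ltW.
have bnd n m t : 0 <= t <= 1 -> `|iter (n + m) T u0 t - iter n T u0 t| <= q ^+ n * K.
  move=> t01; apply: le_trans (iter_tail_bound n m c0 hM t01) _.
  by rewrite ler_wpM2r// gerBl exprn_ge0.
have qK : (q ^+ n * K) @[n --> \oo] --> (0 : R).
  rewrite -[X in _ --> X](mul0r K); apply: cvgM; last exact: cvg_cst.
  by apply: cvg_expr; rewrite ger0_norm.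
have cvu t : 0 <= t <= 1 -> cvgn (fun n => iter n T u0 t).
  move=> t01; apply/cauchy_cvgP/cauchy_exP => e e0.
  move/cvgrPdist_lt : qK => /(_ e e0) [N _ HN].
  exists (iter N T u0 t); exists N => // n /= Nn.
  rewrite -(subnKC Nn) /ball/= distrC; apply: le_lt_trans (bnd N (n - N)%N t t01) _.
  have := HN N (leqnn N); rewrite /= sub0r normrN; apply: le_lt_trans; exact: ler_norm.
pose l t := limn (fun n => iter n T u0 t).
have lu n t : 0 <= t <= 1 -> `|l t - iter n T u0 t| <= q ^+ n * K.
  move=> t01.
  have c1 : `|iter (m + n) T u0 t - iter n T u0 t| @[m --> \oo] --> `|l t - iter n T u0 t|.
    apply: cvg_norm; apply: cvgB; last exact: cvg_cst.
    by rewrite (cvg_shiftn n (fun m => iter m T u0 t)); exact: cvu.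
  apply: (cvgr_to_le c1); apply: nearW => m; rewrite addnC; exact: bnd.
have ucv : {uniform `[0%R, 1%R], (fun n => iter n T u0) @ \oo --> l}.
  by apply: (uniform_cvg_geometric q01) => n t; rewrite /= in_itv/=; exact: lu.
have cl : cont01 l.
  apply: (@uniform_limit_continuous_subspace _ _ _ ((fun n => iter n T u0) @ \oo)) => //.
  by near_simpl; apply: nearW => n; exact: iter_cont.
exists l => // t t01; apply/eqP; rewrite -subr_eq0 -normr_le0.
(* [T l] and [l] both lie within [q ^+ n.+1 * K] of the iterate of rank [n.+1]. *)
have c2 : (q ^+ n * K * 2) @[n --> \oo] --> (0 : R).
  by rewrite -[X in _ --> X](mul0r (2 : R)); apply: cvgM; [exact: qK|exact: cvg_cst].
apply: (cvgr_to_ge c2); apply: nearW => n.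
have h1 := T_contr cl (@iter_cont n _ c0) (lu n) t01.
have h2 := lu n.+1 t t01; rewrite exprS in h2.
rewrite (_ : T l t - l t = (T l t - T (iter n T u0) t) - (l t - T (iter n T u0) t)); last by ring.
apply: le_trans (ler_normB _ _) _; apply: le_trans (lerD h1 h2) _.
have : 0 <= q ^+ n * K by rewrite mulr_ge0// exprn_ge0.
nra.
Qed.

Lemma iter_to_fixpoint (l u : R -> R) : cont01 l -> (forall t, 0 <= t <= 1 -> T l t = l t) ->
  cont01 u -> {uniform `[0%R, 1%R], (fun n => iter n T u) @ \oo --> l}.
Proof.
move=> cl Tl cu; have [M _ hM] := cont01_dist_bounded cl cu.
apply: (@uniform_cvg_geometric _ _ _ q M q01) => n t; rewrite /= in_itv/= => t01.
have -> : l t = iter n T l t.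
  elim: n t t01 => //= n IH t t01; rewrite -[LHS]Tl//; apply/eqP.
  (* Contraction with bound 0: on [[0, 1]], [T u] depends only on the values of [u] there, so the
     pointwise fixed-point equation passes to iterates. *)
  rewrite -subr_eq0 -normr_le0 -[leRHS](mulr0 q).
  apply: T_contr => // [|s s01]; first exact: iter_cont.
  by rewrite -IH// subrr normr0.
exact: iter_contraction.
Qed.

Lemma fixpoint_unique (l v : R -> R) : cont01 l -> cont01 v ->
  (forall t, 0 <= t <= 1 -> T l t = l t) -> (forall t, 0 <= t <= 1 -> T v t = v t) ->
  forall t, 0 <= t <= 1 -> v t = l t.
Proof.
move=> cl cv Tl Tv t t01; have [M M0 hM] := cont01_dist_bounded cv cl.
have /andP[q0 q1] := q01.
have qM : (q ^+ n * M) @[n --> \oo] --> (0 : R).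
  rewrite -[X in _ --> X](mul0r M); apply: cvgM; last exact: cvg_cst.
  by apply: cvg_expr; rewrite ger0_norm.
apply/eqP; rewrite -subr_eq0 -normr_le0; apply: (cvgr_to_ge qM); apply: nearW => n.
elim: n t t01 => [t t01|n IH t t01]; first by rewrite expr0 mul1r hM.
by rewrite -Tl// -Tv// exprS -mulrA; exact: T_contr.
Qed.

End contraction.

End picard_iteration.

Theorem theorem5p1 (R : realType) (alpha lambda Cf : R) (f : R -> R -> R) :
  0 < alpha -> 0 < lambda ->
  {within `[0%R, 1%R] `*` [set: R], continuous (fun p : R * R => f p.1 p.2)} ->
  0 < Cf ->
  (forall t x1 x2 : R, 0 <= t <= 1 ->
    `|f t x1 - f t x2| <= Cf * `|x1 - x2|) ->
  ((alpha * (lambda + Cf))%:E *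
     \int[@lebesgue_measure R]_(s in `]0%R, +oo[)
        (lower_gammaP s alpha^-1)%:E < 1)%E ->
  exists ustar : R -> R,
    [/\ is_solution alpha lambda f ustar,
        forall v : R -> R, is_solution alpha lambda f v ->
          forall t : R, 0 <= t <= 1 -> v t = ustar t &
        forall u0 : R -> R, {within `[0%R, 1%R], continuous u0} ->
          (forall n : nat,
             {within `[0%R, 1%R], continuous (iter n (picard alpha lambda f) u0)}) /\
          {uniform `[0%R, 1%R],
             (fun n : nat => iter n (picard alpha lambda f) u0) @ \oo --> ustar}].
Proof.
move=> alpha0 lambda0 cf Cf0 lipf; rewrite integral_lower_gammaP => small.
have c0 : 0 < alpha * (lambda + Cf) by rewrite mulr_gt0// addr_gt0.
have HS0 : (0 <= econv heaviside (@eS R) alpha^-1)%E.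
  exact: (nnm_econv (@nnm_heaviside R) (@nnm_eS R)).2.
have HS : (econv heaviside (@eS R) alpha^-1 < +oo)%E.
  rewrite ltey; apply/eqP => h; move: small; rewrite h gt0_muley ?lte_fin ?c0 //.
have kS := kernel_of_S alpha0.
have S1 := econv_heaviside_S_lty alpha0 HS.
have [h hE h0] : exists2 h : R, econv heaviside (@eS R) alpha^-1 = h%:E & 0 <= h.
  by move: HS0 HS; case: (econv _ _ _) => // r r0 _; exists r.
have SE : econv heaviside (ekerS alpha) 1 = (alpha * h)%:E.
  by rewrite (econv_heaviside_S alpha0) hE.
pose q := (lambda + Cf) * (alpha * h).
have q01 : 0 <= q < 1.
  move: small; rewrite hE -EFinM lte_fin mulrAC [_ * (lambda + Cf)]mulrC => small.
  by rewrite small andbT mulr_ge0 ?mulr_ge0 ?(ltW alpha0) ?(ltW (addr_gt0 _ _)).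
have Tc (u : R -> R) : {within `[0%R, 1%R], continuous u} ->
    {within `[0%R, 1%R], continuous (picard alpha lambda f u)}.
  move=> cu; rewrite (_ : picard alpha lambda f u
    = rconv (fun t => kernelS (t / alpha)) (rhs lambda f u)).
    exact: (convS_continuous alpha0 HS (@rhs_continuous R lambda f cf u cu)).
  by apply/funext => t; rewrite picardE.
have Tq (u v : R -> R) (M : R) : {within `[0%R, 1%R], continuous u} -> {within `[0%R, 1%R], continuous v} ->
    (forall t, 0 <= t <= 1 -> `|u t - v t| <= M) -> forall t, 0 <= t <= 1 ->
    `|picard alpha lambda f u t - picard alpha lambda f v t| <= q * M.
  move=> cu cv uv t /andP[t0 t1].
  have [bu bv] := (bounded_measurable_restr01 (@rhs_continuous R lambda f cf u cu),
    bounded_measurable_restr01 (@rhs_continuous R lambda f cf v cv)).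
  have nS : nnm (ekerS alpha) by case: kS.
  have St := econv_heaviside_lty nS t1 S1.
  have M0 : 0 <= M by apply: le_trans (uv 0 _); rewrite ?normr_ge0// lexx ler01.
  have lM : 0 <= (lambda + Cf) * M by rewrite mulr_ge0// ltW// addr_gt0.
  rewrite !picardE -(rconv_restr01 _ (rhs _ _ u) t1) -(rconv_restr01 _ (rhs _ _ v) t1).
  rewrite (rconvB kS bu bv St).
  apply: (@le_trans _ _ ((lambda + Cf) * M * fine (econv heaviside (ekerS alpha) t))).
    apply: (rconv_bound kS _ St lM).
      split; first by apply: measurable_funB; [exact: bu.1|exact: bv.1].
      have [[_ [A hA]] [_ [B hB]]] := (bu, bv).
      by exists (A + B) => y; exact: le_trans (ler_normB _ _) (lerD (hA y) (hB y)).
    move=> y /andP[y0 yt]; have y01 : 0 <= y <= 1 by apply/andP; split; lra.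
    rewrite !restr01E// /rhs.
    rewrite (_ : _ - _ = (f y (u y) - f y (v y)) - lambda * (u y - v y)); last by ring.
    apply: le_trans (ler_normB _ _) _; rewrite normrM (gtr0_norm lambda0).
    have := lipf y (u y) (v y) y01; have := uv y y01; nra.
  (* The integral of the kernel up to [t] is enlarged to the one up to 1, which makes the ratio
     independent of [t]. *)
  rewrite [q * M]mulrAC; apply: ler_wpM2l => //.
  rewrite -lee_fin -SE fineK.
    exact: nd_econv_heaviside.
  rewrite ge0_fin_numE; first exact: St.
  exact: (nnm_econv (@nnm_heaviside R) nS).2.
have [l cl Tl] := contraction_fixpoint q01 Tc Tq.
have lfix t : 0 <= t <= 1 ->
  l t = rconv (fun s => kernelS (s / alpha)) (rhs lambda f l) t.
  by move=> t01; rewrite -picardE Tl.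
exists l; split.
- exact: (fixed_solution alpha0 HS cf cl lfix).
- move=> v sv; have cv : {within `[0%R, 1%R], continuous v} by case: sv.
  apply: (fixpoint_unique q01 Tq cl cv Tl) => t t01.
  by rewrite picardE -(solution_fixed alpha0 HS cf sv t01).
move=> u0 cu0; split; first by move=> n; exact: iter_cont.
exact: (iter_to_fixpoint q01 Tc Tq cl Tl cu0).
Qed.
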